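(* Let $N$ be a normal subgroup of the discrete group $G$. Let $\varphi$ be a character of $G$. Assume that $$\varphi_{|N}=\frac1n(\psi_1+\cdots+\psi_n)$$ for some $n\in\mathbb{N}$ and some family of pairwise disjoint traces $\psi_1,\dots,\psi_n$ of the group $N$ permuted transitively by the $G$-action. Then each trace $\psi_i$ can be extended to a character $\varphi_i$ of the isotropy group $G_i=\mathrm{stab}_G(\psi_i)$ so that $$\varphi=\mathrm{Ind}^G_{G_i}\varphi_i.$$
   Context: A trace on a discrete group $G$ is a positive-definite, conjugation-invariant function $\varphi:G\to\mathbb{C}$ with $\varphi(e)=1$. A character of $G$ is a trace that is not a proper convex combination of traces (an extreme point of the convex set of traces). Two traces $\varphi_1,\varphi_2$ on a group $N$ are disjoint if the only positive-definite conjugation-invariant function $\psi:N\to\mathbb{C}$ with $\psi(e)\le1$ such that both $\varphi_1-\psi$ and $\varphi_2-\psi$ are positive definite is $\psi=0$. $G$ acts on traces of the normal subgroup $N$ by $\psi^g(n)=\psi(g^{-1}ng)$. Induction: for a finite index subgroup $H\le G$ and a trace $\psi$ on $H$, let $\widetilde\psi:G\to\mathbb{C}$ be the extension of $\psi$ by $0$ outside $H$ and $\widetilde\psi^{\,g}(x)=\widetilde\psi(g^{-1}xg)$. Then $\mathrm{Ind}^G_H\psi=\frac{1}{[G:H]}\sum_{g\in G/H}\widetilde\psi^{\,g}$. (This applies here since each $G_i$ has index $n$ in $G$.) *)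

(* Defs.v *)
From HB Require Import structures.
From mathcomp Require Import all_boot all_order all_algebra.
From mathcomp Require Import finmap complex.
From mathcomp Require Import boolp classical_sets cardinality fsbigop reals.

Set Implicit Arguments.
Unset Strict Implicit.
Unset Printing Implicit Defensive.

Import Order.TTheory GRing.Theory Num.Theory.

Local Open Scope ring_scope.
Local Open Scope complex_scope.
Local Open Scope classical_set_scope.

(* Groups are arbitrary (possibly infinite) [groupType]s; a subgroup of [G] is
   a [groupClosed] predicate on [G], and [subgroup H] is that subgroup regarded
   as a group in its own right.  Complex numbers are [R[i]]; there, [0 <= z]
   means that [z] is real and nonnegative. *)

Section Subgroup.
Variables (G : groupType) (H : groupClosed G).

Record subgroup := Subgroup { sgval : G; sgvalP : sgval \in H }.

HB.instance Definition _ := [isSub for sgval].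
HB.instance Definition _ := [Choice of subgroup by <:].

Fact subgroup_group_closed : group_closed (fun x => x \in H).
Proof. by split; [exact: gpred1 | exact: gpredF]. Qed.

HB.instance Definition _ :=
  SubChoice_isSubGroup.Build G (fun x => x \in H) subgroup
    subgroup_group_closed.

End Subgroup.

Section Traces.
Variables (R : realType) (G : groupType).
Implicit Types f : G -> R[i].

Definition positive_definite f : Prop :=
  forall (m : nat) (g : 'I_m -> G) (c : 'I_m -> R[i]),
    0 <= \sum_(j < m) \sum_(k < m) (c j)^* * c k * f ((g j)^-1 * g k)%g.

Definition conj_invariant f : Prop := forall x g : G, f (x ^ g)%g = f x.

Definition is_trace f : Prop :=
  [/\ positive_definite f, conj_invariant f & f 1%g = 1].

Definition is_character f : Prop :=
  is_trace f /\
  forall (f1 f2 : G -> R[i]) (t : R), is_trace f1 -> is_trace f2 ->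
    0 < t < 1 -> (forall x, f x = t%:C * f1 x + (1 - t)%:C * f2 x) ->
    f1 =1 f2.

Definition disjoint_traces (f1 f2 : G -> R[i]) : Prop :=
  forall p : G -> R[i], positive_definite p -> conj_invariant p ->
    p 1%g <= 1 ->
    positive_definite (fun x => f1 x - p x) ->
    positive_definite (fun x => f2 x - p x) ->
    p =1 (fun=> 0).

End Traces.

Definition is_normal (G : groupType) (N : groupClosed G) : Prop :=
  forall x g : G, x \in N -> (x ^ g)%g \in N.

Section Action.
Variables (R : realType) (G : groupType) (N : groupClosed G).
Hypothesis nN : is_normal N.

Definition conj_in (g : G) (x : subgroup N) : subgroup N :=
  Subgroup (nN g (sgvalP x)).

(* [x ^ g] is [g^-1 * x * g], so this is a left action. *)
Definition trace_act (g : G) (psi : subgroup N -> R[i]) : subgroup N -> R[i] :=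
  fun x => psi (conj_in g x).

Definition isotropy (psi : subgroup N -> R[i]) : {pred G} :=
  [pred g | `[< trace_act g psi = psi >]].

Lemma trace_act1 psi : trace_act 1%g psi = psi.
Proof.
by apply/funext => x; congr psi; apply/val_inj; rewrite /= conjg1.
Qed.

Lemma trace_actM g h psi :
  trace_act (g * h)%g psi = trace_act g (trace_act h psi).
Proof.
by apply/funext => x; congr psi; apply/val_inj; rewrite /= conjgM.
Qed.

Lemma isotropyP psi g : reflect (trace_act g psi = psi) (g \in isotropy psi).
Proof. exact: asboolP. Qed.

Fact isotropy1 psi : 1%g \in isotropy psi.
Proof. exact/isotropyP/trace_act1. Qed.

Fact isotropyM psi : mulg_closed (isotropy psi).
Proof.
by move=> g h /isotropyP eg /isotropyP eh; apply/isotropyP; rewrite trace_actM eh.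
Qed.

Fact isotropyV psi : invg_closed (isotropy psi).
Proof.
move=> g /isotropyP eg; apply/isotropyP.
by rewrite -[in LHS]eg -trace_actM mulVg trace_act1.
Qed.

HB.instance Definition _ psi :=
  isMulClosed.Build G (isotropy psi) (@isotropyM psi).
HB.instance Definition _ psi := isMul1Closed.Build G (isotropy psi) (isotropy1 psi).
HB.instance Definition _ psi := isInvClosed.Build G (isotropy psi) (@isotropyV psi).

Definition permuted_transitively (n : nat)
    (psi : 'I_n -> subgroup N -> R[i]) : Prop :=
  (forall g i, exists j, trace_act g (psi i) = psi j) /\
  (forall i j, exists g, trace_act g (psi i) = psi j).

End Action.

Arguments trace_act {R G N} nN g psi x.
Arguments isotropy {R G N} nN psi.

(* [F] on the subgroup [H] extends [f] on the subgroup [K]; this includes the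
   inclusion of [K] in [H]. *)
Definition extends (R : realType) (G : groupType) (K H : groupClosed G)
    (f : subgroup K -> R[i]) (F : subgroup H -> R[i]) : Prop :=
  forall x : subgroup K, exists2 y : subgroup H, val y = val x & F y = f x.

Section Induction.
Variables (R : realType) (G : groupType) (H : groupClosed G).

Definition zero_ext (psi : subgroup H -> R[i]) (x : G) : R[i] :=
  if insub x is Some y then psi y else 0.

Definition lcoset (g : G) : set G := [set x | (g^-1 * x)%g \in H].

Definition lcosets : set (set G) := range lcoset.

Definition finite_index : Prop := finite_set lcosets.

(* The index when it is finite, and 0 otherwise. *)
Definition subgroup_index : nat := #|` fset_set lcosets|%fset.

(* Each left coset [c] contributes through a chosen representative; for
   conjugation-invariant [psi] the summand does not depend on the choice. *)
Definition Ind (psi : subgroup H -> R[i]) (x : G) : R[i] :=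
  subgroup_index%:R^-1 *
  \sum_(c \in lcosets) zero_ext psi (x ^ (xget 1%g c))%g.

End Induction.

Arguments Ind {R G H} psi x.

(* Main.v *)
Require Import Defs.
From mathcomp Require Import all_boot all_order all_algebra.
From mathcomp Require Import finmap complex.
From mathcomp Require Import boolp classical_sets cardinality fsbigop reals.
From mathcomp Require Import ring lra.

Set Implicit Arguments.
Unset Strict Implicit.
Unset Printing Implicit Defensive.

Import Order.TTheory GRing.Theory Num.Theory.
Local Open Scope ring_scope.
Import ComplexField.Normc.
Local Open Scope complex_scope.
Local Open Scope ring_scope.
Local Notation Re := complex.Re.
Local Notation Im := complex.Im.
(** Write S for psi_1 + ... + psi_n, which is the restriction of n phi to N.
    In the Hilbert space L^2(S) of the trace S, each psi_i has a density: there
    is a positive contraction T_i with psi_i(a) = S(T_i a).  The T_i commute,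
    since S is a trace, and they add up to 1.  The functional with density
    T_i^2 T_j^2 is positive and conjugation-invariant, and it lies below both
    psi_i and psi_j; so disjointness gives T_i T_j = 0 for distinct i and j,
    and the T_i are orthogonal central projections p_i of sum 1
    ([disjoint_dominated_eq0], [product_functional],
    [approx_central_projections]).

    As N is normal, G permutes the p_i as it permutes the psi_i.  The function
    Phi_i(g) = n phi(p_i g p_i) on G is therefore positive definite, restricts
    to psi_i on N and is carried to Phi_j by any g that carries psi_i to psi_j.
    If g moves psi_i, then p_i g p_i = g p_j p_i = 0 for some j other than i;
    so Phi_i vanishes outside G_i ([piece_off]).  Since n phi is tracial, the
    Phi_i add up to n phi ([piece_sum]).  These facts say exactly that phi_i,
    the restriction of Phi_i to G_i, is a trace that extends psi_i and induces
    phi.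

    For extremality, let phi_i be a proper convex combination of two traces a
    and b of G_i.  Then phi is the same combination of the traces induced by a
    and b, and both of these equal phi because phi is a character.  Now a is
    bounded on N by a multiple of psi_i, so compression by p_i keeps a and
    kills its other conjugates: compressing the equality of phi and Ind a gives
    a = phi_i ([piece_unique]), and likewise b = phi_i.

    The proof below stays inside the group algebras and replaces the vectors
    p_i and T_i 1 of L^2 by elements that approximate them.  A near-minimiser
    of a quadratic energy plays the part of the Riesz vector ([riesz]), and
    every functional obtained as a limit comes with an explicit error bound, so
    that identities between limits follow from [le0_of_small]. *)

(** * Complex numbers and limits with explicit errors *)

Section ComplexNumbers.
Variable R : realType.
Implicit Types (z w : R[i]) (a b C : R).

Lemma normc_conj z : normc z^* = normc z.
Proof. by case: z => a b /=; rewrite sqrrN. Qed.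

Lemma normc_ge0 z : 0 <= normc z.
Proof. by case: z => a b; exact: sqrtr_ge0. Qed.

Lemma normc_add z w : normc (z + w) <= normc z + normc w.
Proof. exact: le_normcD. Qed.

Lemma normc_opp z : normc (- z) = normc z.
Proof. exact: normcN. Qed.

Lemma normc_sub z w : normc (z - w) <= normc z + normc w.
Proof. by rewrite -(normc_opp w) normc_add. Qed.

Lemma normc_le_dist z w : normc z <= normc (z - w) + normc w.
Proof. by rewrite -{1}(subrK w z) normc_add. Qed.

Lemma sqr_normcE z : normc z ^+ 2 = Re z ^+ 2 + Im z ^+ 2.
Proof. by case: z => a b /=; rewrite sqr_sqrtr // addr_ge0 ?sqr_ge0. Qed.

Lemma normc_real a : normc a%:C = `|a|.
Proof. by rewrite /= expr0n addr0 sqrtr_sqr. Qed.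

Lemma normc_Re z : `|Re z| <= normc z.
Proof.
by rewrite -ler_sqr ?nnegrE ?normc_ge0 ?normr_ge0 // sqr_normcE
  real_normK ?num_real // lerDl sqr_ge0.
Qed.

Lemma normc_Im z : `|Im z| <= normc z.
Proof.
by rewrite -ler_sqr ?nnegrE ?normc_ge0 ?normr_ge0 // sqr_normcE
  real_normK ?num_real // lerDr sqr_ge0.
Qed.

Lemma normc_le_ReIm z : normc z <= `|Re z| + `|Im z|.
Proof.
rewrite -ler_sqr ?nnegrE ?normc_ge0 ?addr_ge0 ?normr_ge0 // sqr_normcE.
rewrite sqrrD !real_normK ?num_real //.
have := mulr_ge0 (normr_ge0 (Re z)) (normr_ge0 (Im z)); lra.
Qed.

Lemma ReD z w : Re (z + w) = Re z + Re w.
Proof. by case: z w => [a b] [c d]. Qed.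

Lemma ReN z : Re (- z) = - Re z.
Proof. by case: z. Qed.

Lemma ImD z w : Im (z + w) = Im z + Im w.
Proof. by case: z w => [a b] [c d]. Qed.

Lemma ImN z : Im (- z) = - Im z.
Proof. by case: z. Qed.

Lemma Re_conj z : Re z^* = Re z.
Proof. by case: z. Qed.

Lemma ge0_ReE z : 0 <= z -> z = (Re z)%:C /\ 0 <= Re z.
Proof. by case: z => a b; rewrite lecE /= => /andP[/eqP-> ->]. Qed.

Lemma le_of_sqr_le (u v : R) : 0 <= u -> 0 <= v -> u ^+ 2 <= v * u -> u <= v.
Proof.
rewrite le_eqVlt => /orP[/eqP<-//|u0] v0.
by rewrite expr2 ler_pM2r.
Qed.

(** All passages to the limit end here: an estimate by a multiple of the
    precision e that holds at every precision. *)
Lemma le0_of_small K a : (forall e, 0 < e <= 1 -> a <= K * e) -> a <= 0.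
Proof.
move=> h; rewrite leNgt; apply/negP => a0.
have K0 : 0 < K by have := h 1; rewrite ltr01 lexx mulr1 => /(_ isT); lra.
have d0 : 0 < a + 2 * K by lra.
have /h : 0 < a / (a + 2 * K) <= 1.
  by rewrite divr_gt0 //= ler_pdivrMr // mul1r; lra.
rewrite mulrA ler_pdivlMr // mulrDr.
suff : 0 < a * a + a * K by lra.
by rewrite addr_gt0 ?mulr_gt0.
Qed.

Lemma normc_eq0_of_small K z :
  (forall e, 0 < e <= 1 -> normc z <= K * e) -> z = 0.
Proof.
move=> /le0_of_small h; apply: eq0_normc; apply/eqP.
by rewrite eq_le h normc_ge0.
Qed.

Lemma ge0_of_approx K z :
  (forall e, 0 < e <= 1 -> exists2 r : R, 0 <= r & normc (z - r%:C) <= K * e) ->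
  0 <= z.
Proof.
move=> h.
have Im0 : Im z = 0.
  apply/eqP; rewrite -normr_le0; apply: (@le0_of_small K) => e /h [r _].
  by apply: le_trans; have := normc_Im (z - r%:C); rewrite ImD ImN subr0.
rewrite lecE Im0 eqxx /= -oppr_le0; apply: (@le0_of_small K) => e /h [r r0].
apply: le_trans; have := normc_Re (z - r%:C); rewrite ReD ReN /= => /ler_normlP[].
lra.
Qed.

(** Common source of the Cauchy-Schwarz inequality and of the Riesz estimate:
    the quadratic is negative at t = - conj(w) / b, or far out along the ray of
    - conj(w) when b = 0. *)
Lemma quadratic_discriminant a b w : 0 <= a -> 0 <= b ->
  (forall t, 0 <= a + 2 * Re (t * w) + normc t ^+ 2 * b) ->
  normc w ^+ 2 <= a * b.
Proof.
move=> a0 b0 h; rewrite leNgt; apply/negP => lt.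
set m := normc w ^+ 2 in lt.
have m0 : 0 < m by apply: le_lt_trans lt; rewrite mulr_ge0.
have {}h s : 0 <= a - 2 * s * m + s ^+ 2 * m * b.
  have := h ((- s)%:C * w^*).
  rewrite normcM normc_conj normc_real normrN exprMn real_normK ?num_real //.
  rewrite -/m.
  suff -> : Re ((- s)%:C * w^* * w) = - s * m by lra.
  rewrite /m sqr_normcE; case: (w) => x y /=; ring.
move: b0; rewrite le_eqVlt => /orP[/eqP b0|b0].
  have := h ((a + 1) / (2 * m)); rewrite -b0 mulr0 addr0.
  suff -> : 2 * ((a + 1) / (2 * m)) * m = a + 1 by lra.
  by field; lra.
have := h b^-1.
have -> : a - 2 * b^-1 * m + b^-1 ^+ 2 * m * b = (a * b - m) / b.
  by field; lra.
by rewrite pmulr_lge0 ?invr_gt0 // => ?; lra.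
Qed.

(** A limit along approximants with prescribed error: the error intervals
    around the [u x] meet pairwise, so the supremum of their left endpoints
    lies in all of them. *)
Lemma real_limit_exists (X : Type) (A : R -> X -> Prop) (u : X -> R) C :
  (exists e x, A e x) ->
  (forall e d x y, A e x -> A d y -> `|u x - u y| <= C * (e + d)) ->
  exists l, forall e x, A e x -> `|l - u x| <= C * e.
Proof.
move=> [e0 [x0 A0]] h.
pose E := [set r : R | exists e x, A e x /\ r = u x - C * e]%classic.
have E0 : E (u x0 - C * e0) by exists e0, x0.
have ubE e x : A e x -> ubound E (u x + C * e).
  move=> Ax _ [d [y [Ay ->]]]; have /ler_normlP[] := h _ _ _ _ Ax Ay; lra.
exists (sup E) => e x Ax; apply/ler_normlP; split.
  suff : u x - C * e <= sup E by lra.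
  by apply: ub_le_sup; [exists (u x + C * e); exact: ubE | exists e, x].
suff : sup E <= u x + C * e by lra.
by apply: ge_sup; [exists (u x0 - C * e0) | exact: ubE].
Qed.

Lemma limit_exists (X : Type) (A : R -> X -> Prop) (u : X -> R[i]) C :
  (exists e x, A e x) ->
  (forall e d x y, A e x -> A d y -> normc (u x - u y) <= C * (e + d)) ->
  exists l, forall e x, A e x -> normc (l - u x) <= 2 * C * e.
Proof.
move=> A0 h.
have [e d x y Ax Ay|a ha] := real_limit_exists (u := fun x => Re (u x)) (C := C) A0.
  apply: le_trans (h _ _ _ _ Ax Ay); apply: le_trans (normc_Re _).
  by rewrite ReD ReN.
have [e d x y Ax Ay|b hb] := real_limit_exists (u := fun x => Im (u x)) (C := C) A0.
  apply: le_trans (h _ _ _ _ Ax Ay); apply: le_trans (normc_Im _).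
  by rewrite ImD ImN.
exists (a +i* b) => e x Ax; apply: le_trans (normc_le_ReIm _) _.
rewrite ReD ReN ImD ImN /=; have := ha _ _ Ax; have := hb _ _ Ax; lra.
Qed.
End ComplexNumbers.

(** * Group algebras and the form of a positive definite function *)

Section GroupAlgebra.
Variables (R : realType) (G : groupType).
Local Notation C := R[i].
Local Notation A := (seq (C * G)).
Implicit Types (f : G -> C) (x y z a b : A) (g h : G) (c : C).

(** A list of pairs stands for the formal sum of the [p.1 * p.2].  No quotient
    is taken: only the values [ev f x] of functions extended linearly matter. *)
Definition ev f x : C := \sum_(p <- x) p.1 * f p.2.
Definition scl c x : A := [seq (c * p.1, p.2) | p <- x].
Definition sub x y : A := x ++ scl (-1) y.
Definition star x : A := [seq (p.1^*, p.2^-1%g) | p <- x].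
Definition mul x y : A := [seq (p.1 * q.1, (p.2 * q.2)%g) | p <- x, q <- y].
Definition mono g : A := [:: (1, g)].
Definition conja h x : A := [seq (p.1, (p.2 ^ h)%g) | p <- x].
Definition l1 x : R := \sum_(p <- x) normc p.1.
(** The sesquilinear form (x, y) |-> f(x^* y), and its seminorm. *)
Definition ip f x y : C := ev f (mul (star x) y).
Definition nm f x : R := Num.sqrt (Re (ip f x x)).

Lemma eq_ev f f' x : f =1 f' -> ev f x = ev f' x.
Proof. by move=> e; apply: eq_bigr => p _; rewrite e. Qed.

Lemma ev_cat f x y : ev f (x ++ y) = ev f x + ev f y.
Proof. exact: big_cat. Qed.

Lemma ev_nil f : ev f [::] = 0.
Proof. exact: big_nil. Qed.

Lemma ev_scl f c x : ev f (scl c x) = c * ev f x.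
Proof. by rewrite /ev big_map mulr_sumr; apply: eq_bigr => p _; rewrite mulrA. Qed.

Lemma ev_sub f x y : ev f (sub x y) = ev f x - ev f y.
Proof. by rewrite ev_cat ev_scl mulN1r. Qed.

Lemma ev_mono f g : ev f (mono g) = f g.
Proof. by rewrite /ev big_seq1 mul1r. Qed.

Lemma ev_mul f x y :
  ev f (mul x y) = ev (fun g => ev (fun h => f (g * h)%g) y) x.
Proof.
rewrite /ev big_allpairs_dep; apply: eq_bigr => p _ /=; rewrite mulr_sumr.
by apply: eq_bigr => q _; rewrite mulrA.
Qed.

Lemma ev_mul_subl f x y z :
  ev f (mul (sub x y) z) = ev f (mul x z) - ev f (mul y z).
Proof. by rewrite !ev_mul ev_sub. Qed.

Lemma ev_star f x : ev f (star x) = (ev (fun g => (f g^-1%g)^*) x)^*.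
Proof.
rewrite /ev big_map rmorph_sum; apply: eq_bigr => p _ /=.
by rewrite rmorphM /= conjCK.
Qed.

Lemma ev_conja f h x : ev f (conja h x) = ev (fun g => f (g ^ h)%g) x.
Proof. by rewrite /ev big_map. Qed.

Lemma ev_exchange (F : G -> G -> C) x y :
  ev (fun g => ev (fun h => F g h) y) x = ev (fun h => ev (fun g => F g h) x) y.
Proof.
rewrite /ev; under eq_bigr do rewrite mulr_sumr.
rewrite exchange_big /=; apply: eq_bigr => q _; rewrite mulr_sumr.
by apply: eq_bigr => p _; rewrite mulrCA.
Qed.

Lemma ev_add f f' x : ev (fun g => f g + f' g) x = ev f x + ev f' x.
Proof. by rewrite /ev -big_split; apply: eq_bigr => p _; rewrite mulrDr. Qed.

Lemma ev_cst_mul f c x : ev (fun g => c * f g) x = c * ev f x.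
Proof. by rewrite /ev mulr_sumr; apply: eq_bigr => p _; rewrite mulrCA. Qed.

Lemma ev_minus f f' x : ev (fun g => f g - f' g) x = ev f x - ev f' x.
Proof. by rewrite /ev -sumrB; apply: eq_bigr => p _; rewrite mulrBr. Qed.

Lemma ev_sum n (F : 'I_n -> G -> C) x :
  ev (fun g => \sum_(i < n) F i g) x = \sum_(i < n) ev (F i) x.
Proof.
by rewrite /ev exchange_big; apply: eq_bigr => p _; rewrite mulr_sumr.
Qed.

Lemma mul_catl x y z : mul (x ++ y) z = mul x z ++ mul y z.
Proof. exact: allpairs_cat. Qed.

Lemma mulA x y z : mul x (mul y z) = mul (mul x y) z.
Proof.
elim: x => [//|p x IH].
have mulC q u v : mul (q :: u) v =
  [seq (q.1 * r.1, (q.2 * r.2)%g) | r <- v] ++ mul u v by [].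
rewrite !mulC mul_catl IH; congr cat.
elim: y {IH} => [//|q y IH]; rewrite !mulC map_cat IH; congr cat.
by rewrite -map_comp; apply: eq_map => r /=; rewrite mulrA mulgA.
Qed.

Lemma mul1 x : mul (mono 1%g) x = x.
Proof.
rewrite /mul /= cats0 -[RHS]map_id; apply: eq_map => -[c g] /=.
by rewrite mul1r mul1g.
Qed.

Lemma starK x : star (star x) = x.
Proof.
rewrite /star -map_comp -[RHS]map_id; apply: eq_map => -[c g] /=.
by rewrite conjCK invgK.
Qed.

Lemma star_sub x y : star (sub x y) = sub (star x) (star y).
Proof.
rewrite /star /sub /scl map_cat -!map_comp; congr cat.
by apply: eq_map => p /=; rewrite rmorphM rmorphN1.
Qed.

Lemma star_mono g : star (mono g) = mono g^-1%g.
Proof. by rewrite /star /= rmorph1. Qed.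

Lemma mul_mono g h : mul (mono g) (mono h) = mono (g * h)%g.
Proof. by rewrite /mul /= mulr1. Qed.

Lemma conja_mul h x y : conja h (mul x y) = mul (conja h x) (conja h y).
Proof.
rewrite /mul /conja map_allpairs allpairs_mapl allpairs_mapr.
by apply: eq_allpairs => p q /=; rewrite conjMg.
Qed.

Lemma conja_star h x : conja h (star x) = star (conja h x).
Proof. by rewrite /conja /star -!map_comp; apply: eq_map => p /=; rewrite conjVg. Qed.

Lemma conja_mono h g : conja h (mono g) = mono (g ^ h)%g.
Proof. by []. Qed.

Lemma conjaK h x : conja h (conja h^-1%g x) = x.
Proof.
by rewrite /conja -map_comp -[RHS]map_id; apply: eq_map => -[c g] /=; rewrite conjgKV.
Qed.

Lemma star_mul f x y : ev f (star (mul x y)) = ev f (mul (star y) (star x)).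
Proof.
rewrite ev_star ev_mul ev_mul ev_exchange ev_star; congr (_ ^*).
apply: eq_ev => g; rewrite ev_star conjCK; apply: eq_ev => h.
by rewrite invgM.
Qed.

Lemma eq_ev_mull f x x' y : (forall f', ev f' x = ev f' x') ->
  ev f (mul x y) = ev f (mul x' y).
Proof. by move=> e; rewrite !ev_mul e. Qed.

Lemma ipE f x y :
  ip f x y = ev (fun h => (ev (fun g => (f (g^-1 * h)%g)^*) x)^*) y.
Proof.
rewrite /ip ev_mul ev_exchange; apply: eq_ev => h.
by rewrite ev_star.
Qed.

Lemma ip_monol f y : ip f (mono 1%g) y = ev f y.
Proof. by rewrite /ip star_mono invg1 mul1. Qed.

Lemma ip_catr f x y z : ip f x (y ++ z) = ip f x y + ip f x z.
Proof. by rewrite !ipE ev_cat. Qed.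

Lemma ip_sclr f c x y : ip f x (scl c y) = c * ip f x y.
Proof. by rewrite !ipE ev_scl. Qed.

Lemma ip_subr f x y z : ip f x (sub y z) = ip f x y - ip f x z.
Proof. by rewrite !ipE ev_sub. Qed.

Lemma ip_catl f x y z : ip f (x ++ y) z = ip f x z + ip f y z.
Proof. by rewrite /ip /star map_cat mul_catl ev_cat. Qed.

Lemma ip_scll f c x y : ip f (scl c x) y = c^* * ip f x y.
Proof.
rewrite /ip !ev_mul -ev_scl; congr ev; rewrite /star /scl -!map_comp.
by apply: eq_map => p /=; rewrite rmorphM.
Qed.

Lemma ip_subl f x y z : ip f (sub x y) z = ip f x z - ip f y z.
Proof. by rewrite ip_catl ip_scll rmorphN1 mulN1r. Qed.

Lemma ip_mull f a x y : ip f (mul a x) y = ip f x (mul (star a) y).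
Proof.
rewrite /ip mulA; apply: eq_ev_mull => f'; exact: star_mul.
Qed.

Lemma ip_mulr f a x y : ip f x (mul a y) = ip f (mul (star a) x) y.
Proof. by rewrite ip_mull starK. Qed.

Lemma eq_ip f x x' : (forall f', ev f' x = ev f' x') -> ip f x x = ip f x' x'.
Proof.
by move=> e; rewrite [LHS]ipE [RHS]ipE e; apply: eq_ev => h; rewrite e.
Qed.

Lemma ip_mono_mul f g x y : ip f (mul (mono g) x) (mul (mono g) y) = ip f x y.
Proof. by rewrite ip_mull mulA star_mono mul_mono mulVg mul1. Qed.

Lemma l1_ge0 x : 0 <= l1 x.
Proof. by apply: sumr_ge0 => p _; exact: normc_ge0. Qed.

Lemma l1_star x : l1 (star x) = l1 x.
Proof. by rewrite /l1 big_map; apply: eq_bigr => p _; rewrite normc_conj. Qed.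

Lemma nm_ge0 f x : 0 <= nm f x.
Proof. exact: sqrtr_ge0. Qed.

Lemma normc_sum (I : Type) (r : seq I) (P : pred I) (F : I -> C) :
  normc (\sum_(i <- r | P i) F i) <= \sum_(i <- r | P i) normc (F i).
Proof.
elim/big_ind2 : _ => [|z a w b ha hb|//]; first by rewrite normc0.
by apply: le_trans (normc_add _ _) _; exact: lerD.
Qed.

Lemma ip_sum f x y :
  ip f x y = \sum_(p <- x) \sum_(q <- y) p.1^* * q.1 * f (p.2^-1 * q.2)%g.
Proof.
rewrite /ip ev_mul /ev big_map; apply: eq_bigr => p _ /=.
by rewrite mulr_sumr; apply: eq_bigr => q _; rewrite mulrA.
Qed.

Lemma positive_definiteP f :
  positive_definite f <-> forall x, 0 <= ip f x x.
Proof.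
split=> h.
  move=> x; rewrite ip_sum !(big_nth (0, 1%g)) big_mkord.
  have := h (size x) (fun i => (nth (0, 1%g) x i).2) (fun i => (nth (0, 1%g) x i).1).
  by under [X in _ -> 0 <= X]eq_bigr do rewrite (big_nth (0, 1%g)) big_mkord.
move=> m g c; have := h [seq (c i, g i) | i <- enum 'I_m].
rewrite ip_sum big_map big_enum /=.
by under [X in 0 <= X -> _]eq_bigr do rewrite big_map big_enum /=.
Qed.

Section PositiveDefinite.
Variable f : G -> C.
Hypothesis pdf : positive_definite f.

Lemma ip_ge0 x : 0 <= ip f x x.
Proof. exact: (positive_definiteP f).1. Qed.

Lemma ip_nm x : ip f x x = (nm f x ^+ 2)%:C.
Proof. by have [e h] := ge0_ReE (ip_ge0 x); rewrite /nm sqr_sqrtr. Qed.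

(** Positivity on c g + 1 makes an expression linear in f(g) and f(g^-1) real;
    c = 1 and c = i give the imaginary and the real part of the claim. *)
Lemma pd_inv g : f g^-1%g = (f g)^*.
Proof.
have expand c : ip f (scl c (mono g) ++ mono 1%g) (scl c (mono g) ++ mono 1%g) =
    c^* * c * f 1%g + c^* * f g^-1%g + c * f g + f 1%g.
  rewrite ip_sum !big_cons !big_nil /= !addr0.
  rewrite ?mulr1 ?rmorph1 /= ?mulr1 ?mul1r ?invg1 ?mul1g ?mulg1 ?mulVg. by rewrite !addrA.
have f1 : Im (f 1%g) = 0.
  by have := ip_ge0 (mono 1%g); rewrite ip_monol ev_mono => /ger0_Im.
have := ip_ge0 (scl 'i%C (mono g) ++ mono 1%g); rewrite expand => /ger0_Im.
have := ip_ge0 (scl 1 (mono g) ++ mono 1%g); rewrite expand => /ger0_Im.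
move: f1; case: (f 1%g) (f g) (f g^-1%g) => a b [u v] [p q] /= -> h1 h2.
by congr (_ +i* _); move: h1 h2; lra.
Qed.

Lemma ip_conj x y : ip f y x = (ip f x y)^*.
Proof.
rewrite !ip_sum exchange_big rmorph_sum; apply: eq_bigr => p _ /=.
rewrite rmorph_sum; apply: eq_bigr => q _ /=.
rewrite !rmorphM /= conjCK -pd_inv invgM invgK. by rewrite [_ * p.1]mulrC.
Qed.

Lemma Re_ipC x y : Re (ip f y x) = Re (ip f x y).
Proof. by rewrite ip_conj Re_conj. Qed.

Lemma nm2E x : nm f x ^+ 2 = Re (ip f x x).
Proof. by rewrite ip_nm. Qed.

Lemma nm2_cat_scl x y c :
  nm f (x ++ scl c y) ^+ 2 =
  nm f x ^+ 2 + 2 * Re (c * ip f x y) + normc c ^+ 2 * nm f y ^+ 2.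
Proof.
rewrite !nm2E ip_catl !ip_catr !ip_scll !ip_sclr !ReD.
rewrite [ip f y x]ip_conj -[c^* * (ip f x y)^*]rmorphM Re_conj.
rewrite sqr_normcE (ip_nm y); case: (c) => u v /=; ring.
Qed.

Lemma cauchy_schwarz x y : normc (ip f x y) <= nm f x * nm f y.
Proof.
rewrite -ler_sqr ?nnegrE ?normc_ge0 ?mulr_ge0 ?nm_ge0 // exprMn.
apply: quadratic_discriminant; rewrite ?sqr_ge0 // => t.
by rewrite -nm2_cat_scl sqr_ge0.
Qed.

Lemma nm_cat x y : nm f (x ++ y) <= nm f x + nm f y.
Proof.
rewrite -ler_sqr ?nnegrE ?addr_ge0 ?nm_ge0 //.
have -> : nm f (x ++ y) ^+ 2 = nm f x ^+ 2 + 2 * Re (ip f x y) + nm f y ^+ 2.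
  by rewrite !nm2E ip_catl !ip_catr !ReD [Re (ip f y x)]Re_ipC; lra.
have := cauchy_schwarz x y; have /ler_normlP[_] := normc_Re (ip f x y).
rewrite sqrrD; lra.
Qed.

Lemma nm_scl c x : nm f (scl c x) = normc c * nm f x.
Proof.
apply/eqP; rewrite -(@eqrXn2 _ 2) ?nm_ge0 ?mulr_ge0 ?normc_ge0 ?nm_ge0 //.
rewrite nm2E ip_scll ip_sclr mulrA exprMn sqr_normcE ip_nm.
by apply/eqP; case: (c) => u v /=; ring.
Qed.

Lemma nm_sub x y : nm f (sub x y) <= nm f x + nm f y.
Proof.
apply: le_trans (nm_cat _ _) _.
by rewrite nm_scl normc_opp normc1 mul1r.
Qed.

Lemma nm_mono_mul g x : nm f (mul (mono g) x) = nm f x.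
Proof. by rewrite /nm ip_mono_mul. Qed.

Lemma nm_nil : nm f [::] = 0.
Proof. by rewrite /nm ip_sum big_nil sqrtr0. Qed.

(** Translations are isometric, so left multiplication by [a] is bounded by the
    l^1 norm of [a]. *)
Lemma nm_mul_le a x : nm f (mul a x) <= l1 a * nm f x.
Proof.
elim: a => [|[c g] a IH]; first by rewrite nm_nil mulr_ge0 ?l1_ge0 ?nm_ge0.
have -> : mul ((c, g) :: a) x = scl c (mul (mono g) x) ++ mul a x.
  rewrite /mul /scl /= cats0 -map_comp; congr cat.
  by apply: eq_map => p /=; rewrite mul1r.
rewrite /l1 big_cons -/(l1 a) mulrDl; apply: le_trans (nm_cat _ _) _.
by rewrite nm_scl nm_mono_mul; exact: lerD.
Qed.

Lemma nm_eq x y : (forall f', ev f' x = ev f' y) -> nm f x = nm f y.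
Proof. by move=> e; rewrite /nm (eq_ip _ e). Qed.

Lemma nm_sub_trans y x z : nm f (sub x z) <= nm f (sub x y) + nm f (sub y z).
Proof.
rewrite (@nm_eq (sub x z) (sub x y ++ sub y z)) ?nm_cat // => f'.
by rewrite ev_cat !ev_sub addrA subrK.
Qed.

Lemma nm_le_sub x y : nm f x <= nm f (sub x y) + nm f y.
Proof.
rewrite (@nm_eq x (sub x y ++ y)) ?nm_cat // => f'.
by rewrite ev_cat !ev_sub subrK.
Qed.

Lemma nm_subC x y : nm f (sub x y) = nm f (sub y x).
Proof.
rewrite (@nm_eq (sub x y) (scl (-1) (sub y x))).
  by rewrite nm_scl normc_opp normc1 mul1r.
by move=> f'; rewrite ev_scl !ev_sub mulN1r opprB.
Qed.

Lemma ev_le x : normc (ev f x) <= nm f (mono 1%g) * nm f x.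
Proof. by rewrite -ip_monol cauchy_schwarz. Qed.

Section Tracial.
Hypothesis clf : conj_invariant f.

Lemma ev_mulC x y : ev f (mul x y) = ev f (mul y x).
Proof.
rewrite !ev_mul ev_exchange; apply: eq_ev => h; apply: eq_ev => g.
by rewrite -(clf (h * g)%g h) conjgE !mulgA mulVg mul1g.
Qed.

Lemma nm_star x : nm f (star x) = nm f x.
Proof. by rewrite /nm /ip starK ev_mulC. Qed.

(** For a trace the involution is isometric, which turns right multiplication
    into left multiplication. *)
Lemma nm_mulr_le a x : nm f (mul x a) <= l1 a * nm f x.
Proof.
rewrite -nm_star (@nm_eq _ (mul (star a) (star x))); last first.
  by move=> f'; rewrite star_mul.
by rewrite -(l1_star a) -(nm_star x); exact: nm_mul_le.
Qed.

End Tracial.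
End PositiveDefinite.

Lemma ev_conja_cl f h x : conj_invariant f -> ev f (conja h x) = ev f x.
Proof. by move=> cl; rewrite ev_conja; apply: eq_ev => g; rewrite cl. Qed.

Lemma ip_conja f h x y : conj_invariant f -> ip f (conja h x) (conja h y) = ip f x y.
Proof. by move=> cl; rewrite /ip -conja_star -conja_mul ev_conja_cl. Qed.

Lemma nm_conja f h x : conj_invariant f -> nm f (conja h x) = nm f x.
Proof. by move=> cl; rewrite /nm ip_conja. Qed.

End GroupAlgebra.
Arguments mono {R G} g.

(** * Limits of vector functionals and approximate Riesz vectors *)

Section Limits.
Variables (R : realType) (G : groupType).
Local Notation C := R[i].
Local Notation A := (seq (C * G)).
Implicit Types (f F : G -> C) (x y z a b w : A) (g h : G) (c : C) (e d k K : R).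

Lemma ip_mul_subr f x a y z :
  ip f x (mul a (sub y z)) = ip f x (mul a y) - ip f x (mul a z).
Proof. by rewrite !(ip_mulr _ a) ip_subr. Qed.

Lemma ip_mul_ev f x a y : ip f x (mul a y) = ev (fun g => ip f x (mul (mono g) y)) a.
Proof.
rewrite ipE ev_mul; apply: eq_ev => g.
by rewrite ipE ev_mul ev_mono.
Qed.

Lemma normc_ev_le F a K : (forall g, normc (F g) <= K) -> normc (ev F a) <= K * l1 a.
Proof.
move=> h; apply: le_trans (normc_sum _ _ _) _; rewrite mulr_sumr.
apply: ler_sum => p _; rewrite normcM mulrC; apply: ler_wpM2r => //.
exact: normc_ge0.
Qed.

(** The vector functionals g |-> <x, g x> of a Cauchy family of vectors converge,
    uniformly on the unit ball of l^1; the limit is the vector functional of the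
    missing limit vector. *)
Lemma limit_state f (X : R -> A -> Prop) K : positive_definite f ->
  (forall e, 0 < e -> exists x, X e x) ->
  (forall e d x y, 0 < e -> 0 < d -> X e x -> X d y ->
     nm f (sub x y) <= K * (e + d)) ->
  exists F k, [/\ positive_definite F, 0 <= k &
    forall e x a, 0 < e <= 1 -> X e x ->
      normc (ev F a - ip f x (mul a x)) <= k * l1 a * e].
Proof.
move=> pdf ex dist.
have [x0 X0] := ex 1 ltr01.
have K0 : 0 <= K.
  have := dist _ _ _ _ ltr01 ltr01 X0 X0; have := nm_ge0 f (sub x0 x0); lra.
pose M := nm f x0 + 2 * K.
have bound e x : 0 < e <= 1 -> X e x -> nm f x <= M.
  move=> /andP[e0 e1] Xx; apply: le_trans (nm_le_sub pdf x x0) _.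
  have := dist _ _ _ _ e0 ltr01 Xx X0.
  have : K * (e + 1) <= K * 2 by apply: ler_wpM2l => //; lra.
  rewrite /M; lra.
have M0 : 0 <= M by rewrite /M addr_ge0 ?nm_ge0 ?mulr_ge0.
have dist2 g e d x y : 0 < e <= 1 -> 0 < d <= 1 -> X e x -> X d y ->
    normc (ip f x (mul (mono g) x) - ip f y (mul (mono g) y)) <= 2 * M * K * (e + d).
  move=> he hd Xx Xy.
  have -> : ip f x (mul (mono g) x) - ip f y (mul (mono g) y) =
     ip f (sub x y) (mul (mono g) x) + ip f y (mul (mono g) (sub x y)).
    by rewrite ip_mul_subr ip_subl; ring.
  apply: le_trans (normc_add _ _) _.
  have D : nm f (sub x y) <= K * (e + d).
    by apply: dist => //; [case/andP: he|case/andP: hd].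
  have := cauchy_schwarz pdf (sub x y) (mul (mono g) x).
  have := cauchy_schwarz pdf y (mul (mono g) (sub x y)).
  rewrite !nm_mono_mul.
  have : nm f (sub x y) * nm f x <= K * (e + d) * M.
    by apply: ler_pM; rewrite ?nm_ge0 // (bound e).
  have : nm f y * nm f (sub x y) <= M * (K * (e + d)).
    by apply: ler_pM; rewrite ?nm_ge0 // (bound d).
  lra.
have /choice[F hF] : forall g, exists l, forall e x, 0 < e <= 1 /\ X e x ->
    normc (l - ip f x (mul (mono g) x)) <= 2 * (2 * M * K) * e.
  move=> g; apply: limit_exists.
    by exists 1, x0; rewrite ltr01 lexx.
  by move=> e d x y [he Xx] [hd Xy]; exact: dist2.
pose c := 2 * (2 * M * K).
have hev e x a : 0 < e <= 1 -> X e x ->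
    normc (ev F a - ip f x (mul a x)) <= c * l1 a * e.
  move=> he Xx; rewrite ip_mul_ev -ev_minus [c * _ * _]mulrAC.
  by apply: normc_ev_le => g; exact: hF.
exists F, c; split => //; last by rewrite /c !mulr_ge0.
apply/positive_definiteP => a.
apply: (@ge0_of_approx _ (c * l1 (mul (star a) a))) => e he.
have [x Xx] := ex e ltac:(by case/andP: he).
exists (nm f (mul a x) ^+ 2); first exact: sqr_ge0.
rewrite -ip_nm // ip_mull mulA; exact: hev.
Qed.

(** [w] represents the functional [F] up to the precision [e] in the dual norm;
    it approximates the Riesz vector of [F] in the completion. *)
Definition approx f F e w := forall b, normc (ip f w b - ev F b) <= e * nm f b.

(** The Riesz vector minimises |w|^2 - 2 Re F(w).  An element that comes within
    e^2 of the infimum is enough: moving it along any [b] gains at most e^2,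
    and the discriminant of that quadratic inequality is the estimate. *)
Lemma riesz f F M : positive_definite f ->
  (forall b, normc (ev F b) <= M * nm f b) ->
  forall e, 0 < e -> exists w, approx f F e w.
Proof.
move=> pdf bd e e0.
pose J w := nm f w ^+ 2 - 2 * Re (ev F w).
have Jlb w : - M ^+ 2 <= J w.
  have := bd w; have /ler_normlP[_] := normc_Re (ev F w).
  have := sqr_ge0 (nm f w - M); rewrite /J sqrrB; lra.
pose E := [set r : R | exists w, r = J w]%classic.
have lbE : has_inf E.
  by split; [exists (J [::]), [::] | exists (- M ^+ 2) => _ [w ->]].
have [_ [w ->] Jw] := @inf_adherent _ E (e ^+ 2) ltac:(by rewrite exprn_gt0) lbE.
exists w => b.
rewrite -ler_sqr ?nnegrE ?normc_ge0 ?mulr_ge0 ?nm_ge0 ?(ltW e0) // exprMn.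
apply: quadratic_discriminant; rewrite ?sqr_ge0 // => t.
have : inf E <= J (w ++ scl t b) by apply: ge_inf; [case: lbE | exists (w ++ scl t b)].
rewrite {1}/J nm2_cat_scl // ev_cat ev_scl ReD mulrBr ReD ReN.
move: Jw; rewrite /J; lra.
Qed.

Section Approx.
Variable f : G -> C.
Hypothesis pdf : positive_definite f.

Lemma approx_dist F e d x y : 0 < e -> 0 < d ->
  approx f F e x -> approx f F d y -> nm f (sub x y) <= e + d.
Proof.
move=> e0 d0 hx hy; set z := sub x y.
apply: le_of_sqr_le; rewrite ?nm_ge0 ?addr_ge0 ?(ltW e0) ?(ltW d0) //.
rewrite nm2E //; apply: le_trans (le_trans (ler_norm _) (normc_Re _)) _.
have -> : ip f z z = (ip f x z - ev F z) - (ip f y z - ev F z).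
  by rewrite {1}/z ip_subl; ring.
apply: le_trans (normc_sub _ _) _; rewrite mulrDl.
exact: lerD (hx z) (hy z).
Qed.

(** With T the Riesz vector of [F], the hypothesis reads <T, a^* b> <= |a|_s |b|,
    and taking b = a T gives |a T| <= |a|_s.  The error is that of [w]. *)
Lemma approx_nm_mul F (s : G -> C) e a w : 0 < e ->
  (forall b, normc (ev F (mul (star a) b)) <= nm s a * nm f b) ->
  approx f F e w -> nm f (mul a w) <= nm s a + e * l1 a.
Proof.
move=> e0 hF hw; set z := mul a w.
apply: le_of_sqr_le; rewrite ?addr_ge0 ?mulr_ge0 ?nm_ge0 ?l1_ge0 ?(ltW e0) //.
rewrite nm2E //; apply: le_trans (le_trans (ler_norm _) (normc_Re _)) _.
rewrite {1}/z ip_mull; apply: le_trans (normc_le_dist _ (ev F (mul (star a) z))) _.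
have := hF z; have := hw (mul (star a) z).
have : e * nm f (mul (star a) z) <= e * (l1 a * nm f z).
  by rewrite ler_pM2l // -l1_star; exact: nm_mul_le.
lra.
Qed.

Lemma approx_conja F e h w : conj_invariant f -> conj_invariant F ->
  approx f F e w -> approx f F e (conja h w).
Proof.
move=> clf clF hw b.
by rewrite -(conjaK h b) ip_conja // ev_conja_cl // nm_conja.
Qed.
End Approx.

End Limits.

(** * Disjoint traces and central projections *)

Section Disjointness.
Variables (R : realType) (G : groupType).
Local Notation C := R[i].
Local Notation A := (seq (C * G)).
Local Notation one := (@mono R G 1%g).
Implicit Types (f F s t S p : G -> C) (x y z a b w : A) (g h : G) (e d k K : R).

Lemma nm_one f : f 1%g = 1 -> nm f one = 1.
Proof. by move=> f1; rewrite /nm ip_monol ev_mono f1 sqrtr1. Qed.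

Lemma l1_one : l1 one = 1.
Proof. by rewrite /l1 big_seq1 normc1. Qed.

Lemma nm_mono f g : nm f (mono g) = nm f one.
Proof. by rewrite -{1}[g]mulg1 -mul_mono nm_mono_mul. Qed.

Lemma pd_minusP s p : positive_definite s -> positive_definite p ->
  positive_definite (fun g => s g - p g) <-> (forall a, nm p a <= nm s a).
Proof.
move=> pds pdp; have ipB a : ip (fun g => s g - p g) a a = (nm s a ^+ 2 - nm p a ^+ 2)%:C.
  by rewrite /ip ev_minus -/(ip s a a) -/(ip p a a) !ip_nm // rmorphB.
split=> [/positive_definiteP h a|h].
  by have := h a; rewrite ipB ler0c subr_ge0 ler_sqr ?nnegrE ?nm_ge0.
by apply/positive_definiteP => a; rewrite ipB ler0c subr_ge0 ler_sqr ?nnegrE ?nm_ge0.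
Qed.

(** The vector functional p of the Riesz vector T of [F] is p(a^* a) = |a T|^2,
    so the two bounds say that p lies below [s] and below [t].  It is
    conjugation-invariant because [F] is; disjointness gives p = 0, hence T = 0
    and [F] = 0. *)
Lemma disjoint_dominated_eq0 S F s t :
  positive_definite S -> conj_invariant S -> conj_invariant F ->
  is_trace s -> is_trace t -> disjoint_traces s t ->
  (forall a b, normc (ev F (mul (star a) b)) <= nm s a * nm S b) ->
  (forall a b, normc (ev F (mul (star a) b)) <= nm t a * nm S b) ->
  F =1 (fun=> 0).
Proof.
move=> pdS clS clF [pds _ s1] [pdt _ _] disj bs bt.
have bF b : normc (ev F b) <= 1 * nm S b.
  by rewrite -(nm_one s1) -{1}[b]mul1 -{1}invg1 -star_mono.
have exw := riesz pdS bF.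
have [e d x y e0 d0 hx hy|p [k [pdp k0 hp]]] := limit_state (K := 1) pdS exw.
  by rewrite mul1r; exact: (approx_dist pdS e0 d0 hx hy).
have clp : conj_invariant p.
  move=> x h; apply/eqP; rewrite -subr_eq0; apply/eqP.
  apply: (@normc_eq0_of_small _ (2 * k)) => e he.
  have [w hw] := exw e ltac:(by case/andP: he).
  have hw' := approx_conja (h^-1)%g clS clF hw.
  have := hp _ _ (mono (x ^ h)%g) he hw; have := hp _ _ (mono x) he hw'.
  rewrite -(ip_conja h) // conja_mul conjaK !ev_mono /l1 !big_seq1 normc1 mulr1.
  rewrite conja_mono; set v := ip _ _ _.
  have -> : p (x ^ h)%g - p x = (p (x ^ h)%g - v) - (p x - v) by ring.
  have := normc_sub (p (x ^ h)%g - v) (p x - v); lra.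
have lep r : positive_definite r ->
    (forall a b, normc (ev F (mul (star a) b)) <= nm r a * nm S b) ->
    positive_definite (fun g => r g - p g).
  move=> pdr br; apply/pd_minusP => // a.
  rewrite -ler_sqr ?nnegrE ?nm_ge0 // -subr_le0.
  apply: (@le0_of_small _ (k * l1 (mul (star a) a) + 2 * (nm r a * l1 a) + l1 a ^+ 2)).
  move=> e he; have /andP[e0 e1] := he; have [w hw] := exw e e0.
  have := hp _ _ (mul (star a) a) he hw.
  rewrite -mulA -ip_mull -/(ip p a a) !ip_nm // -rmorphB normc_real => /ler_normlP[_].
  have : nm S (mul a w) ^+ 2 <= (nm r a + e * l1 a) ^+ 2.
    by rewrite ler_sqr ?nnegrE ?addr_ge0 ?mulr_ge0 ?nm_ge0 ?l1_ge0 ?(ltW e0) //;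
       exact: (approx_nm_mul pdS).
  rewrite sqrrD exprMn.
  have : e ^+ 2 * l1 a ^+ 2 <= e * l1 a ^+ 2.
    by apply: ler_wpM2r; rewrite ?sqr_ge0 // expr2 ler_piMl // ltW.
  lra.
have p1 : p 1%g <= 1.
  have /positive_definiteP/(_ one) := lep s pds bs.
  by rewrite ip_monol ev_mono s1 subr_ge0.
have p0 := disj p pdp clp p1 (lep s pds bs) (lep t pdt bt).
move=> g; set B := nm S (mono g).
apply: eq0_normc; apply/eqP; rewrite -sqrf_eq0 eq_le sqr_ge0 andbT.
apply: (@le0_of_small _ (2 * (1 + k) * B ^+ 2)) => e he.
have /andP[e0 e1] := he; have [w hw] := exw e e0.
have wk : nm S w ^+ 2 <= k * e.
  have := hp _ _ one he hw; rewrite ev_mono p0 mul1 ip_nm // sub0r normc_opp.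
  by rewrite normc_real ger0_norm ?sqr_ge0 // l1_one mulr1.
have gb : normc (F g) <= (e + nm S w) * B.
  rewrite -(ev_mono F) -normc_opp mulrDl.
  have := hw (mono g); have := cauchy_schwarz pdS w (mono g); rewrite -/B.
  have := normc_sub (ip S w (mono g) - ev F (mono g)) (ip S w (mono g)).
  have -> : ip S w (mono g) - ev F (mono g) - ip S w (mono g) = - ev F (mono g) by ring.
  lra.
have : normc (F g) ^+ 2 <= ((e + nm S w) * B) ^+ 2.
  by rewrite ler_sqr ?nnegrE ?normc_ge0 // (le_trans (normc_ge0 _) gb).
move/le_trans; apply; rewrite exprMn [_ * B ^+ 2 * e]mulrAC.
apply: ler_wpM2r; rewrite ?sqr_ge0 //.
have := sqr_ge0 (e - nm S w); rewrite sqrrB sqrrD.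
have : e ^+ 2 <= e by rewrite expr2 ler_piMl // ltW.
lra.
Qed.

Section Product.
Variables S s t : G -> C.
Hypotheses (pdS : positive_definite S) (clS : conj_invariant S).
Hypotheses (pds : positive_definite s) (cls : conj_invariant s).
Hypotheses (pdt : positive_definite t) (clt : conj_invariant t).
Hypotheses (sS : forall a, nm s a <= nm S a) (tS : forall a, nm t a <= nm S a).

Lemma ip_le_dominated r : positive_definite r -> (forall a, nm r a <= nm S a) ->
  forall a b, normc (ev r (mul (star a) b)) <= nm r a * nm S b.
Proof.
move=> pdr rS a b; apply: le_trans (cauchy_schwarz pdr a b) _.
by apply: ler_wpM2l; rewrite ?nm_ge0.
Qed.

Lemma riesz_dominated r e : positive_definite r -> (forall a, nm r a <= nm S a) ->
  0 < e -> exists w, approx S r e w.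
Proof.
move=> pdr rS; apply: (riesz (M := nm r one) pdS) => b.
have := ip_le_dominated pdr rS one b.
by rewrite star_mono invg1 mul1.
Qed.

Lemma approx_nm r e w : positive_definite r -> (forall a, nm r a <= nm S a) ->
  0 < e -> approx S r e w -> nm S w <= nm r one + e.
Proof.
move=> pdr rS e0 hw.
have := approx_nm_mul pdS e0 (ip_le_dominated pdr rS one) hw.
by rewrite mul1 l1_one mulr1.
Qed.

(** Let s and t have the densities T_s and T_t with respect to S.  Then
    s(T_t b) = S(T_s T_t b) and t(T_s b) = S(T_t T_s b); these agree because all
    three functionals are tracial, which lets the two approximants change
    sides. *)
Lemma approx_swap e x y b : 0 < e <= 1 -> approx S s e x -> approx S t e y ->
  normc (ip s y b - ip t x b) <= (nm s one + nm t one + 2) * l1 b * e.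
Proof.
move=> /andP[e0 e1] hx hy.
have h1 := hx (mul b (star y)); have h2 := hy (mul (star x) b).
have y1 := approx_nm pdt tS e0 hy; have x1 := approx_nm pds sS e0 hx.
move: h1; rewrite (ev_mulC cls) -/(ip s y b) /ip mulA (ev_mulC clS) -/(ip s y b).
move: h2; rewrite -/(ip t x b) /ip.
set u := ev S _; rewrite -/(ip s y b) -/(ip t x b) => h2 h1.
have : e * nm S (mul b (star y)) <= e * (l1 b * (nm t one + 1)).
  apply: ler_wpM2l; first exact: ltW.
  apply: le_trans (nm_mul_le pdS _ _) _; apply: ler_wpM2l; first exact: l1_ge0.
  rewrite nm_star //; lra.
have : e * nm S (mul (star x) b) <= e * (l1 b * (nm s one + 1)).
  apply: ler_wpM2l; first exact: ltW.
  apply: le_trans (nm_mulr_le pdS clS _ _) _; apply: ler_wpM2l; first exact: l1_ge0.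
  rewrite nm_star //; lra.
have := normc_sub (u - ip t x b) (u - ip s y b).
have -> : u - ip t x b - (u - ip s y b) = ip s y b - ip t x b by ring.
lra.
Qed.

(** The functional b |-> S(T_s T_t b), obtained as the limit of s(y^* b) along
    the approximants [y] of T_t.  Both bounds come from T_s, T_t <= 1; the one
    by [s] needs the two densities to be exchanged. *)
Lemma product_functional : exists F, [/\ conj_invariant F,
  (forall a b, normc (ev F (mul (star a) b)) <= nm s a * nm S b),
  (forall a b, normc (ev F (mul (star a) b)) <= nm t a * nm S b) &
  forall e y b, 0 < e <= 1 -> approx S t e y ->
    normc (ev F b - ip s y b) <= e * nm S b].
Proof.
have dist e d y z b : 0 < e -> 0 < d -> approx S t e y -> approx S t d z ->
    normc (ip s y b - ip s z b) <= (e + d) * nm S b.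
  move=> e0 d0 hy hz; rewrite -ip_subl; apply: le_trans (cauchy_schwarz pds _ _) _.
  apply: ler_pM; rewrite ?nm_ge0 //; apply: le_trans (sS _) _.
  exact: (approx_dist pdS e0 d0 hy hz).
pose k := 2 * nm S one.
have /choice[F hF] : forall g, exists l, forall e y, 0 < e <= 1 /\ approx S t e y ->
    normc (l - ip s y (mono g)) <= k * e.
  move=> g; apply: limit_exists.
    have [y hy] := riesz_dominated pdt tS ltr01.
    by exists 1, y; rewrite ltr01 lexx.
  move=> e d y z [/andP[e0 _] hy] [/andP[d0 _] hz].
  by rewrite -(nm_mono S g) mulrC; exact: dist.
have evF e y b : 0 < e <= 1 -> approx S t e y ->
    normc (ev F b - ip s y b) <= k * l1 b * e.
  move=> he hy.
  have -> : ip s y b = ev (fun g => ip s y (mono g)) b.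
    by rewrite ipE; apply: eq_ev => g; rewrite ipE ev_mono.
  by rewrite -ev_minus [k * _ * _]mulrAC; apply: normc_ev_le => g; exact: hF.
have evF' e y b : 0 < e <= 1 -> approx S t e y ->
    normc (ev F b - ip s y b) <= e * nm S b.
  move=> he hy; rewrite -subr_le0.
  apply: (@le0_of_small _ (k * l1 b + nm S b)) => d hd.
  have /andP[e0 _] := he; have /andP[d0 _] := hd.
  have [z hz] := riesz_dominated pdt tS d0.
  have := evF d z b hd hz; have := dist d e z y b d0 e0 hz hy.
  have := normc_add (ev F b - ip s z b) (ip s z b - ip s y b).
  by rewrite addrA subrK; lra.
exists F; split => //.
- move=> x h; apply/eqP; rewrite -subr_eq0; apply/eqP.
  apply: (@normc_eq0_of_small _ (2 * k)) => e he.
  have [w hw] := riesz_dominated pdt tS (proj1 (andP he)).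
  have hw' := approx_conja (h^-1)%g clS clt hw.
  have := hF (x ^ h)%g _ _ (conj he hw); have := hF x _ _ (conj he hw').
  rewrite -(ip_conja h) // conjaK conja_mono; set v := ip _ _ _.
  have -> : F (x ^ h)%g - F x = (F (x ^ h)%g - v) - (F x - v) by ring.
  have := normc_sub (F (x ^ h)%g - v) (F x - v); lra.
- move=> a b; rewrite -subr_le0; set c := mul (star a) b.
  apply: (@le0_of_small _
    (nm S c + (nm s one + nm t one + 2) * l1 c + l1 a * nm S b)) => e he.
  have /andP[e0 _] := he.
  have [y hy] := riesz_dominated pdt tS e0; have [x hx] := riesz_dominated pds sS e0.
  have := evF' e y c he hy; have := approx_swap c he hx hy.
  have : normc (ip t x c) <= (nm s a + e * l1 a) * nm S b.
    rewrite /c -ip_mull; apply: le_trans (cauchy_schwarz pdt _ _) _.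
    apply: ler_pM; rewrite ?nm_ge0 //; apply: le_trans (tS _) _.
    exact: (approx_nm_mul pdS e0 (ip_le_dominated pds sS a) hx).
  have := normc_add (ev F c - ip s y c) (ip s y c).
  have := normc_add (ip s y c - ip t x c) (ip t x c).
  rewrite !subrK; lra.
- move=> a b; rewrite -subr_le0; set c := mul (star a) b.
  apply: (@le0_of_small _ (nm S c + l1 a * nm S b)) => e he.
  have /andP[e0 _] := he.
  have [y hy] := riesz_dominated pdt tS e0.
  have := evF' e y c he hy.
  have : normc (ip s y c) <= (nm t a + e * l1 a) * nm S b.
    rewrite /c -ip_mull; apply: le_trans (cauchy_schwarz pds _ _) _.
    apply: ler_pM; rewrite ?nm_ge0 //; apply: le_trans (sS _) _.
    exact: (approx_nm_mul pdS e0 (ip_le_dominated pdt tS a) hy).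
  have := normc_add (ev F c - ip s y c) (ip s y c).
  rewrite !subrK; lra.
Qed.
End Product.

(** T_s T_t = 0, read on an approximant of T_t. *)
Lemma approx_disjoint S s t e y : positive_definite S -> conj_invariant S ->
  is_trace s -> is_trace t -> disjoint_traces s t ->
  (forall a, nm s a <= nm S a) -> (forall a, nm t a <= nm S a) ->
  0 < e <= 1 -> approx S t e y -> nm s y ^+ 2 <= 2 * e.
Proof.
move=> pdS clS trs trt disj sS tS he hy.
have [pds cls s1] := trs; have [pdt clt t1] := trt.
have [F [clF Fs Ft hF]] := product_functional pdS clS pds cls pdt clt sS tS.
have F0 := disjoint_dominated_eq0 pdS clS clF trs trt disj Fs Ft.
have := hF e y y he hy; rewrite (eq_ev y F0) /ev big1 => [|i _]; last by rewrite mulr0.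
rewrite sub0r normc_opp ip_nm // normc_real ger0_norm ?sqr_ge0 //.
move/le_trans; apply; have /andP[e0 e1] := he; rewrite mulrC ler_pM2r //.
by have := approx_nm pdS pdt tS e0 hy; rewrite (nm_one t1); lra.
Qed.

(** The value of the i-th central projection in L^2(psi_j): the projections are
    orthogonal, of sum 1, and the j-th is the support of psi_j. *)
Definition Kronecker n (i j : 'I_n) : A := if i == j then one else [::].

Lemma ev_bigcat (I : Type) (r : seq I) (P : pred I) (x : I -> A) f :
  ev f (\big[cat/[::]]_(i <- r | P i) x i) = \sum_(i <- r | P i) ev f (x i).
Proof. by apply: (big_morph (ev f)) => [u v|]; [exact: ev_cat | exact: ev_nil]. Qed.

Lemma nm_bigcat (I : Type) (r : seq I) (P : pred I) (x : I -> A) f :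
  positive_definite f ->
  nm f (\big[cat/[::]]_(i <- r | P i) x i) <= \sum_(i <- r | P i) nm f (x i).
Proof.
move=> pdf; elim/big_ind2 : _ => [|u a v b ua vb|//]; first by rewrite nm_nil.
by apply: le_trans (nm_cat pdf _ _) _; exact: lerD.
Qed.

Lemma ip_bigcatl (I : Type) (r : seq I) (P : pred I) (x : I -> A) f y :
  ip f (\big[cat/[::]]_(i <- r | P i) x i) y = \sum_(i <- r | P i) ip f (x i) y.
Proof.
apply: (big_morph (fun x => ip f x y)) => [u v|]; first exact: ip_catl.
by rewrite ip_sum big_nil.
Qed.

Section SumOfTraces.
Variables (n : nat) (psi : 'I_n -> G -> C).
Hypothesis pd_psi : forall i, positive_definite (psi i).
Let S g := \sum_(i < n) psi i g.

Lemma ip_sumf x y : ip S x y = \sum_(i < n) ip (psi i) x y.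
Proof. exact: ev_sum. Qed.

Lemma pd_sum : positive_definite S.
Proof.
apply/positive_definiteP => x; rewrite ip_sumf.
by apply: sumr_ge0 => i _; exact: ip_ge0.
Qed.

Lemma nm2_sum x : nm S x ^+ 2 = \sum_(i < n) nm (psi i) x ^+ 2.
Proof.
apply: complexI; rewrite rmorph_sum -(ip_nm pd_sum) ip_sumf.
by apply: eq_bigr => i _; exact: ip_nm.
Qed.

Lemma nm_le_sum i x : nm (psi i) x <= nm S x.
Proof.
rewrite -ler_sqr ?nnegrE ?nm_ge0 // nm2_sum (bigD1 i) //= lerDl.
by apply: sumr_ge0 => j _; exact: sqr_ge0.
Qed.

Lemma nm_sum_le x : nm S x <= \sum_(i < n) nm (psi i) x.
Proof.
rewrite -ler_sqr ?nnegrE ?nm_ge0 ?sumr_ge0 ?nm_ge0 // => [|i _]; last exact: nm_ge0.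
rewrite nm2_sum expr2 mulr_suml; apply: ler_sum => i _.
rewrite expr2; apply: ler_wpM2l; rewrite ?nm_ge0 // (bigD1 i) //= lerDl.
by apply: sumr_ge0 => j _; exact: nm_ge0.
Qed.
End SumOfTraces.

(** The densities T_i satisfy T_i T_j = 0 for distinct i and j, and their sum is
    the density 1 of S; so T_i acts as 1 in L^2(psi_i) and as 0 in the other
    L^2(psi_j). *)
Lemma approx_central_projections n (psi : 'I_n -> G -> C) :
  (forall i, is_trace (psi i)) ->
  (forall i j, i != j -> disjoint_traces (psi i) (psi j)) ->
  forall e, 0 < e -> exists y : 'I_n -> A,
    forall i j, nm (psi j) (sub (y i) (Kronecker i j)) <= e.
Proof.
move=> tr disj e e0.
have pd_psi i : positive_definite (psi i) by case: (tr i).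
set S : G -> C := fun g => \sum_(i < n) psi i g.
have pdS : positive_definite S := pd_sum pd_psi.
have clS : conj_invariant S.
  by move=> g h; apply: eq_bigr => i _; have [_ -> _] := tr i.
pose N : R := n%:R; have N0 : 0 <= N := ler0n _ _.
(* d <= 1 and 2 n d <= e; off-diagonal norms will be at most d. *)
pose d := e / (e + 2 * N + 1).
have D0 : 0 < e + 2 * N + 1 by lra.
have d0 : 0 < d by rewrite divr_gt0.
have d1 : d <= 1 by rewrite ler_pdivrMr // mul1r; lra.
have Nd : 2 * N * d <= e.
  rewrite mulrA ler_pdivrMr // [_ * e]mulrC; apply: ler_wpM2l; lra.
have dd : d ^+ 2 <= d by rewrite expr2 ler_piMl // ltW.
(* The precision u gives norms at most sqrt (2 u) = d. *)
pose u := d ^+ 2 / 2.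
have u0 : 0 < u by rewrite divr_gt0 ?exprn_gt0.
have u1 : u <= 1 by rewrite /u; lra.
have le_psi i x : nm (psi i) x <= nm S x := nm_le_sum pd_psi i x.
have /choice[y hy] : forall i, exists w, approx S (psi i) u w.
  by move=> i; exact: (riesz_dominated pdS (pd_psi i) (le_psi i)).
exists y.
have off i j : i != j -> nm (psi j) (y i) <= d.
  move=> ij; rewrite -ler_sqr ?nnegrE ?nm_ge0 ?(ltW d0) //.
  have -> : d ^+ 2 = 2 * u by rewrite /u; field.
  apply: (@approx_disjoint S (psi j) (psi i) u) => //; last by rewrite u0.
  by apply: disj; rewrite eq_sym.
move=> i j; rewrite /Kronecker; case: eqVneq => [<-{j}|ij]; last first.
  rewrite /sub cats0; apply: le_trans (off _ _ ij) _; rewrite -[d]mulr1.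
  rewrite /d -mulrA; apply: ler_piMr; first exact: ltW.
  by rewrite mulr1 invf_le1 //; lra.
pose tot := \big[cat/[::]]_(k < n) y k.
pose rest := \big[cat/[::]]_(k < n | k != i) y k.
have htot : nm S (sub tot one) <= N * u.
  set z := sub tot one.
  apply: le_of_sqr_le; [exact: nm_ge0 | exact: mulr_ge0 N0 (ltW u0) |].
  rewrite (nm2E pdS); apply: le_trans (le_trans (ler_norm _) (normc_Re _)) _.
  have -> : ip S z z = \sum_(k < n) (ip S (y k) z - ev (psi k) z).
    by rewrite {1}/z ip_subl ip_bigcatl ip_monol ev_sum sumrB.
  apply: le_trans (normc_sum _ _ _) _; rewrite -mulrA /N mulr_natl.
  rewrite -[X in _ *+ X]card_ord -sumr_const.
  by apply: ler_sum => k _; exact: hy.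
have hrest : nm (psi i) rest <= N * d.
  apply: le_trans (nm_bigcat _ _ _ (pd_psi i)) _.
  apply: le_trans (_ : \sum_(k < n) d <= _); last first.
    by rewrite sumr_const card_ord /N mulr_natl.
  rewrite big_mkcond; apply: ler_sum => k _; case: ifP => [/off//|_]; exact: ltW.
rewrite (@nm_eq _ _ _ _ (sub (sub tot one) rest)).
  apply: le_trans (nm_sub (pd_psi i) _ _) _.
  have := le_psi i (sub tot one); have : N * u <= N * d by rewrite ler_wpM2l // /u; lra.
  lra.
move=> f; rewrite !ev_sub !ev_bigcat (bigD1 i) //=; ring.
Qed.

End Disjointness.

(** * Subgroups and extension by zero *)

Section Subgroups.
Variables (R : realType) (G : groupType) (K : groupClosed G).
Local Notation C := R[i].
Implicit Types (f : G -> C) (x y z : seq (C * subgroup K)) (a : subgroup K -> C).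

Definition vmap x : seq (C * G) := [seq (p.1, val p.2) | p <- x].

Lemma ev_vmap f x : ev f (vmap x) = ev (f \o val) x.
Proof. by rewrite /ev big_map. Qed.

Lemma vmap_mul x y : vmap (mul x y) = mul (vmap x) (vmap y).
Proof. by rewrite /vmap /mul map_allpairs allpairs_mapl allpairs_mapr. Qed.

Lemma vmap_star x : vmap (star x) = star (vmap x).
Proof. by rewrite /vmap /star -!map_comp. Qed.

Lemma vmap_sub x y : vmap (sub x y) = sub (vmap x) (vmap y).
Proof. by rewrite /vmap /sub /scl map_cat -!map_comp. Qed.

Lemma vmap_mono (k : subgroup K) : vmap (mono k) = mono (val k).
Proof. by []. Qed.

Lemma ip_vmap f x y : ip f (vmap x) (vmap y) = ip (f \o val) x y.
Proof. by rewrite /ip -vmap_star -vmap_mul ev_vmap. Qed.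

Lemma pd_restrict f : positive_definite f -> positive_definite (f \o @sgval G K).
Proof.
move=> /positive_definiteP h; apply/positive_definiteP => x.
by rewrite -ip_vmap.
Qed.

Lemma vmap_lift (u : seq (C * G)) : all (fun p => p.2 \in K) u -> exists x, u = vmap x.
Proof.
elim: u => [|[c g] u IH] /=; first by exists [::].
by move=> /andP[gK /IH[x ->]]; exists ((c, Subgroup gK) :: x).
Qed.

Lemma zero_ext_val a k : zero_ext a (val k) = a k.
Proof. by rewrite /zero_ext valK. Qed.

Lemma zero_ext_in a g (gK : g \in K) : zero_ext a g = a (Subgroup gK).
Proof. exact: (zero_ext_val a (Subgroup gK)). Qed.

Lemma zero_ext_notin a g : g \notin K -> zero_ext a g = 0.
Proof. by move=> gK; rewrite /zero_ext insubN. Qed.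

Lemma zero_ext_conj a g k : conj_invariant a -> k \in K ->
  zero_ext a (g ^ k)%g = zero_ext a g.
Proof.
move=> cla kK; have gkK : ((g ^ k)%g \in K) = (g \in K).
  by rewrite conjgE gpredMl ?gpredV // gpredMr.
case: (boolP (g \in K)) => gK; last by rewrite !zero_ext_notin ?gkK.
rewrite (zero_ext_in _ gK) -(cla _ (Subgroup kK)) -zero_ext_val; congr zero_ext.
Qed.

(** Elements of different left cosets of [K] are orthogonal for the extended
    form, so a formal sum splits into its parts on cosets; each part is a
    translate of an element of the group algebra of [K].  The coset of the head
    of the list is split off first. *)
Lemma zero_ext_pd a : positive_definite a -> positive_definite (zero_ext a).
Proof.
move=> /positive_definiteP pda; apply/positive_definiteP => x.
have [m] := ubnP (size x); elim: m x => // m IH [|[c g] x] sx.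
  by rewrite ip_sum big_nil.
set y := (c, g) :: x; pose P (p : C * G) := (g^-1 * p.2)%g \in K.
pose y1 := [seq p <- y | P p]; pose y2 := [seq p <- y | ~~ P p].
have Py : forall f, ev f y = ev f (y1 ++ y2).
  by move=> f; rewrite ev_cat /ev !big_filter [LHS](bigID P).
have cross u v : (forall p q, p \in u -> q \in v -> P p != P q) ->
    ip (zero_ext a) u v = 0.
  move=> huv; rewrite ip_sum big_seq big1 // => p pu.
  rewrite big_seq big1 // => q qv; rewrite zero_ext_notin ?mulr0 //.
  apply: contra (huv p q pu qv) => pq; rewrite /P -[q.2](mulVKg p.2) mulgA.
  by rewrite (gpredMr _ pq) eqxx.
have in1 p : p \in y1 -> P p by rewrite mem_filter => /andP[].
have in2 p : p \in y2 -> P p = false by rewrite mem_filter => /andP[/negbTE].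
rewrite (eq_ip _ Py) ip_catl !ip_catr.
rewrite [ip _ y1 y2]cross => [|p q /in1-> /in2->//].
rewrite [ip _ y2 y1]cross => [|p q /in2-> /in1->//].
rewrite addr0 add0r; apply: addr_ge0; last first.
  apply: IH; apply: leq_trans (sx : (size x < m)%N); rewrite /y2 /=.
  have -> : P (c, g) by rewrite /P mulVg gpred1.
  by rewrite size_filter ltnS count_size.
rewrite -(ip_mono_mul _ g^-1%g).
have [|z ->] := vmap_lift (u := mul (mono g^-1%g) y1).
  by apply/allP => _ /allpairsP[[p q] [/= + /in1 Pq ->]]; rewrite inE => /eqP->.
by rewrite ip_vmap /ip (eq_ev _ (zero_ext_val a)); exact: pda.
Qed.

End Subgroups.

(** * Cosets of an isotropy group *)

Section IsotropyCosets.
Variables (R : realType) (G : groupType) (N : groupClosed G) (nN : is_normal N).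
Variables (n : nat) (psi : 'I_n -> subgroup N -> R[i]).
Hypothesis psi_inj : injective psi.
Variables (i : 'I_n) (r : 'I_n -> G).
Hypothesis orbit_psi : forall g, exists j, trace_act nN g (psi i) = psi j.
Hypothesis r_psi : forall j, trace_act nN (r j) (psi i) = psi j.
Local Notation H := (isotropy nN (psi i)).

Lemma trace_act_inj g : injective (@trace_act R G N nN g).
Proof.
move=> s t e; rewrite -(trace_act1 nN s) -(trace_act1 nN t) -(mulVg g).
by rewrite !trace_actM e.
Qed.

Lemma mem_isotropy_div g h :
  ((g^-1 * h)%g \in H) <-> trace_act nN h (psi i) = trace_act nN g (psi i).
Proof.
split=> [/isotropyP e|e].
  by rewrite -{2}e -trace_actM mulVKg.
by apply/isotropyP; rewrite trace_actM e -trace_actM mulVg trace_act1.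
Qed.

Lemma lcoset_isotropy g :
  lcoset H g = [set x | trace_act nN x (psi i) = trace_act nN g (psi i)]%classic.
Proof. by apply/seteqP; split=> x; rewrite /lcoset /= => /mem_isotropy_div. Qed.

Definition coset_seq : seq (set G) := [seq lcoset H (r j) | j <- enum 'I_n].

Lemma coset_seq_uniq : uniq coset_seq.
Proof.
rewrite map_inj_uniq ?enum_uniq // => j k e; apply: psi_inj.
have : lcoset H (r j) (r j) by rewrite lcoset_isotropy.
by rewrite e lcoset_isotropy /= !r_psi.
Qed.

Lemma mem_coset_seq c : c \in coset_seq <-> lcosets H c.
Proof.
split=> [/mapP[j _ ->]|[g _ <-]]; first by exists (r j).
have [j gj] := orbit_psi g; apply/mapP; exists j; first by rewrite mem_enum.
by rewrite !lcoset_isotropy r_psi gj.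
Qed.

Lemma finite_isotropy : finite_index H.
Proof.
rewrite /finite_index (_ : lcosets H = [set` coset_seq]%classic); first exact: finite_seq.
by apply/seteqP; split=> c /mem_coset_seq.
Qed.

Lemma perm_cosets : perm_eq (fset_set (lcosets H)) coset_seq.
Proof.
apply: uniq_perm; rewrite ?fset_uniq ?coset_seq_uniq // => c.
rewrite in_fset_set; last exact: finite_isotropy.
by apply/idP/idP => [/set_mem/mem_coset_seq|/mem_coset_seq/mem_set].
Qed.

Lemma index_isotropy : subgroup_index H = n.
Proof.
by rewrite /subgroup_index (perm_size perm_cosets) size_map size_enum_ord.
Qed.

Lemma zero_ext_coset (a : subgroup H -> R[i]) x g h : conj_invariant a ->
  trace_act nN g (psi i) = trace_act nN h (psi i) ->
  zero_ext a (x ^ g)%g = zero_ext a (x ^ h)%g.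
Proof.
move=> cla /mem_isotropy_div e.
by rewrite -[g](mulVKg h) conjgM zero_ext_conj.
Qed.

(** The left cosets of the isotropy group correspond to the orbit of psi_i, which
    has the n distinct elements psi_j; so the chosen coset representatives may
    be replaced by any [r j] that carries psi_i to psi_j. *)
Lemma IndE (a : subgroup H -> R[i]) x : conj_invariant a ->
  Ind a x = n%:R^-1 * \sum_(j < n) zero_ext a (x ^ r j)%g.
Proof.
move=> cla; rewrite /Ind index_isotropy; congr (_ * _).
rewrite fsbig_finite; last exact: finite_isotropy.
rewrite (perm_big _ perm_cosets) big_map big_enum /=.
apply: eq_bigr => j _; apply: zero_ext_coset => //.
have : lcoset H (r j) (xget 1%g (lcoset H (r j))).
  by apply: (xgetPex 1%g); exists (r j); rewrite lcoset_isotropy.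
by rewrite {1}lcoset_isotropy.
Qed.
End IsotropyCosets.

(** * Splitting a character along a disjoint decomposition *)

Section Clifford.
Variables (R : realType) (G : groupType) (N : groupClosed G) (nN : is_normal N).
Local Notation C := R[i].
Local Notation M := (subgroup N).
Variables (phi : G -> C) (n : nat) (psi : 'I_n -> M -> C).
Hypothesis phi_trace : is_trace phi.
Hypothesis psi_trace : forall i, is_trace (psi i).
Hypothesis psi_disj : forall i j, i != j -> disjoint_traces (psi i) (psi j).
Hypothesis psi_perm : permuted_transitively nN psi.
Hypothesis phi_restr : forall x : M, phi (val x) = n%:R^-1 * \sum_(i < n) psi i x.
Local Notation act g i j := (trace_act nN g (psi i) = psi j).
Local Notation one := (@mono R M 1%g).
Local Notation oneG := (@mono R G 1%g).
Local Notation delta := (@Kronecker R M n).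

Let pd_psi i : positive_definite (psi i).
Proof. by case: (psi_trace i). Qed.

Let cl_psi i : conj_invariant (psi i).
Proof. by case: (psi_trace i). Qed.

Let psi1 i : psi i 1%g = 1.
Proof. by case: (psi_trace i). Qed.

(** A trace is not disjoint from itself. *)
Lemma psi_inj : injective psi.
Proof.
move=> i j e; apply/eqP; apply: contraT => /psi_disj disj.
have z : positive_definite (fun x => psi i x - psi i x).
  by apply/pd_minusP => //; exact: pd_psi.
have := disj _ (pd_psi i) (cl_psi i) _ z _ 1%g.
rewrite -e psi1 => /(_ (lexx _) z) /eqP.
by rewrite oner_eq0.
Qed.

Definition conjN h (y : seq (C * M)) : seq (C * M) :=
  [seq (p.1, conj_in nN h p.2) | p <- y].

Lemma vmap_conjN h y : vmap (conjN h y) = conja h (vmap y).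
Proof. by rewrite /vmap /conja -!map_comp. Qed.

Lemma conj_in1 h : conj_in nN h 1%g = 1%g.
Proof. by apply: val_inj; rewrite /= conj1g. Qed.

Lemma nm_conjN f h y : nm f (conjN h y) = nm (trace_act nN h f) y.
Proof.
rewrite /nm !ip_sum /conjN big_map; congr (Num.sqrt (Re _)).
apply: eq_bigr => p _; rewrite big_map; apply: eq_bigr => q _ /=.
congr (_ * f _); apply: val_inj; rewrite /= !conjgE.
by rewrite !invgM !invgK !mulgA mulgK.
Qed.

(** [y] is within [e] of the i-th central projection in each L^2(psi_j). *)
Definition near i (e : R) y := forall j, nm (psi j) (sub y (delta i j)) <= e.

Lemma near_exists i e : 0 < e -> exists y, near i e y.
Proof.
by move=> e0; have [y hy] := approx_central_projections psi_trace psi_disj e0; exists (y i).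
Qed.

Lemma near_conj h i j e y : act h i j -> near j e y -> near i e (conjN h y).
Proof.
move=> hij hy m; have [m' hm] := psi_perm.1 h m.
have -> : sub (conjN h y) (delta i m) = conjN h (sub y (delta j m')).
  rewrite /sub /scl /conjN map_cat -!map_comp /Kronecker; congr cat.
  have -> : (i == m) = (j == m').
    by apply/eqP/eqP => e'; subst; apply: psi_inj; rewrite -?hij -?hm //;
       apply: (@trace_act_inj _ _ _ nN h); rewrite hij hm.
  by case: eqP => //= _; rewrite conj_in1.
by rewrite nm_conjN hm; exact: hy.
Qed.

Lemma near_star i e y : near i e y -> near i e (star y).
Proof.
move=> hy j; rewrite -(nm_star (cl_psi j)) star_sub starK.
suff -> : star (delta i j) = delta i j by exact: hy.
by rewrite /Kronecker; case: ifP => // _; rewrite star_mono invg1.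
Qed.

Lemma near_off i j e y : i != j -> near i e y -> nm (psi j) y <= e.
Proof.
by move=> /negbTE ij /(_ j); rewrite /Kronecker ij /sub cats0.
Qed.

Lemma near_nm i j e y : near i e y -> nm (psi j) y <= e + 1.
Proof.
move=> hy; apply: le_trans (nm_le_sub (pd_psi j) y (delta i j)) _.
apply: lerD (hy j) _; rewrite /Kronecker; case: ifP => _; first by rewrite nm_one.
by rewrite nm_nil.
Qed.

Definition nphi g := n%:R * phi g.
Local Notation f := nphi.

Lemma nphi_restr : f \o @sgval G N =1 fun x => \sum_(i < n) psi i x.
Proof.
case: (posnP n) => [n0|n0] x.
  by rewrite /= /f; move: psi; rewrite n0 => psi'; rewrite mul0r big_ord0.
rewrite /= /f (phi_restr x) mulrA divff ?mul1r //.
by rewrite pnatr_eq0 -lt0n.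
Qed.

Lemma pd_nphi : positive_definite f.
Proof.
apply/positive_definiteP => x; rewrite /ip ev_cst_mul mulr_ge0 ?ler0n //.
by apply: ip_ge0; case: phi_trace.
Qed.

Lemma cl_nphi : conj_invariant f.
Proof. by move=> x g; rewrite /f; case: phi_trace => _ -> _. Qed.

Lemma ip_nphi_vmap x y : ip f (vmap x) (vmap y) = \sum_(i < n) ip (psi i) x y.
Proof. by rewrite ip_vmap -ip_sumf /ip; apply: eq_ev; exact: nphi_restr. Qed.

Lemma nm_nphi_vmap x : nm f (vmap x) <= \sum_(i < n) nm (psi i) x.
Proof.
apply: le_trans _ (nm_sum_le pd_psi x).
by rewrite /nm ip_nphi_vmap ip_sumf.
Qed.

Lemma near_dist i e d x y : near i e x -> near i d y ->
  nm f (sub (vmap x) (vmap y)) <= n%:R * (e + d).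
Proof.
move=> hx hy; rewrite -vmap_sub; apply: le_trans (nm_nphi_vmap _) _.
rewrite (mulr_natl _ n) -[X in _ *+ X]card_ord -sumr_const; apply: ler_sum => j _.
apply: le_trans (nm_sub_trans (pd_psi j) (delta i j) _ _) _.
by rewrite [nm _ (sub (delta i j) y)]nm_subC //; exact: lerD.
Qed.

(** The relation p_j p_i = delta_ij p_i, tested against g.  Approximants are
    bounded in L^2 only, so p_j is first approximated by z' at a precision d
    that is small compared with the l^1 norm of y; this controls the product
    z' y.  Replacing z' by z costs the L^2 distance of z and z' times the L^2
    norm of y. *)
Lemma near_product : exists c, forall i j e y z g, 0 < e <= 1 ->
  near i e y -> near j e z ->
  normc (ev f (mul (vmap z) (mul (vmap y) (mono g))) -
         (i == j)%:R * ev f (mul (vmap y) (mono g))) <= c * e.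
Proof.
pose nR : R := n%:R; have nR0 : 0 <= nR := ler0n _ _.
exists (4 * nR * nR + 2 * (nR * nm f oneG)) => i j e y z g /andP[e0 e1] hy hz.
pose d := e / (l1 y + 1); have l0 := l1_ge0 y.
have d0 : 0 < d by rewrite divr_gt0 //; lra.
have de : d <= e by rewrite /d ler_pdivrMr ?ler_peMr //; lra.
have ld : l1 y * d <= e.
  by rewrite /d mulrCA ler_piMr ?(ltW e0) // ler_pdivrMr ?mul1r; lra.
have [z' hz'] := near_exists j d0.
pose w := if i == j then y else [::].
(* u is the defect of p_j p_i = delta_ij p_i at the approximants z' and y. *)
pose u := sub (mul z' y) w.
have nu m : nm (psi m) u <= 2 * e.
  have -> : nm (psi m) u =
      nm (psi m) (mul (sub z' (delta j m)) y ++ sub (mul (delta j m) y) w).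
    apply: nm_eq => F; rewrite ev_sub [RHS]ev_cat !ev_sub !ev_mul ev_sub; ring.
  apply: le_trans (nm_cat (pd_psi m) _ _) _.
  have : nm (psi m) (mul (sub z' (delta j m)) y) <= e.
    apply: le_trans (nm_mulr_le (pd_psi m) (cl_psi m) _ _) _.
    by apply: le_trans ld; apply: ler_wpM2l.
  suff : nm (psi m) (sub (mul (delta j m) y) w) <= e by lra.
  rewrite /w /Kronecker; case: (eqVneq j m) => [<-|jm]; rewrite ?mul1 /=.
    case: (eqVneq i j) => [ij|ij]; last by rewrite /sub cats0 (near_off ij).
    rewrite (@nm_eq _ _ _ _ [::]) ?nm_nil ?(ltW e0) // => F.
    by rewrite ev_sub subrr ev_nil.
  case: (eqVneq i j) => [ij|ij]; last by rewrite /sub nm_nil ltW.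
  rewrite nm_scl // normc_opp normc1 mul1r; apply: near_off hy.
  by rewrite ij.
have nU : nm f (vmap u) <= nR * (2 * e).
  apply: le_trans (nm_nphi_vmap _) _.
  by rewrite (mulr_natl _ n) -[X in _ *+ X]card_ord -sumr_const; apply: ler_sum.
have nY : nm f (vmap y) <= nR * 2.
  apply: le_trans (nm_nphi_vmap _) _.
  rewrite (mulr_natl _ n) -[X in _ *+ X]card_ord -sumr_const; apply: ler_sum => m _.
  by apply: le_trans (near_nm m hy) _; lra.
set Y := vmap y in nY *; set Z := vmap z; set Z' := vmap z'.
have -> : ev f (mul Z (mul Y (mono g))) - (i == j)%:R * ev f (mul Y (mono g)) =
    ev f (mul (sub Z Z') (mul Y (mono g))) + ev f (mul (vmap u) (mono g)).
  rewrite /u vmap_sub vmap_mul -/Y -/Z' !ev_mul_subl -!mulA.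
  rewrite /w; case: eqP => _; first by rewrite -/Y mul1r; ring.
  by rewrite mul0r ev_nil; ring.
have r1 X : nm f (mul X (mono g)) <= nm f X.
  apply: le_trans (nm_mulr_le pd_nphi cl_nphi _ _) _.
  by rewrite /l1 big_seq1 normc1 mul1r.
apply: le_trans (normc_add _ _) _.
have : normc (ev f (mul (sub Z Z') (mul Y (mono g)))) <= (nR * (e + d)) * (nR * 2).
  rewrite -[sub Z Z']starK; apply: le_trans (cauchy_schwarz pd_nphi _ _) _.
  rewrite nm_star; last exact: cl_nphi.
  apply: ler_pM; rewrite ?nm_ge0 //; first exact: (near_dist hz hz').
  exact: le_trans (r1 _) nY.
have : normc (ev f (mul (vmap u) (mono g))) <= nm f oneG * (nR * (2 * e)).
  apply: le_trans (ev_le pd_nphi _) _; apply: ler_wpM2l; first exact: nm_ge0.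
  exact: le_trans (r1 _) nU.
have : nR * (e + d) * (nR * 2) <= nR * (2 * e) * (nR * 2).
  by apply: ler_wpM2r; [rewrite mulr_ge0 | apply: ler_wpM2l => //; lra].
lra.
Qed.

(** Phi_i(g) = n phi(p_i g p_i), with a common constant for all error bounds. *)
Lemma pieces_exist : exists (Phi : 'I_n -> G -> C) (k : R),
  (forall i, positive_definite (Phi i)) /\
  (forall i e y g, 0 < e <= 1 -> near i e y ->
    normc (Phi i g - ip f (vmap y) (mul (mono g) (vmap y))) <= k * e).
Proof.
have /choice[Phi hPhi] : forall i, exists F : G -> C, positive_definite F /\
    exists k, 0 <= k /\ forall e y g, 0 < e <= 1 -> near i e y ->
    normc (F g - ip f (vmap y) (mul (mono g) (vmap y))) <= k * e.
  move=> i.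
  have [||F [k [pdF k0 hF]]] := limit_state (f := f)
      (X := fun e x => exists2 y, x = vmap y & near i e y) (K := n%:R) pd_nphi.
  - by move=> e /(near_exists i)[y hy]; exists (vmap y), y.
  - by move=> e d _ _ e0 d0 [x -> hx] [y -> hy]; exact: near_dist hx hy.
  exists F; split=> //; exists k; split=> // e y g he hy.
  have := hF e _ (mono g) he (ex_intro2 _ _ y erefl hy).
  by rewrite ev_mono /l1 big_seq1 normc1 mulr1.
have /choice[k hk] := fun i => (hPhi i).2.
exists Phi, (\sum_i k i); split=> [i|i e y g he hy]; first by case: (hPhi i).
apply: le_trans ((hk i).2 e y g he hy) _; apply: ler_wpM2r; first by case/andP: he => /ltW.
by rewrite (bigD1 i) //= lerDl; apply: sumr_ge0 => j _; case: (hk j).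
Qed.

Section Pieces.
Variables (Phi : 'I_n -> G -> C) (k : R).
Hypothesis pd_Phi : forall i, positive_definite (Phi i).
Hypothesis PhiP : forall i e y g, 0 < e <= 1 -> near i e y ->
  normc (Phi i g - ip f (vmap y) (mul (mono g) (vmap y))) <= k * e.

Lemma ip_rotate (x : seq (C * G)) g :
  ip f x (mul (mono g) x) = ev f (mul x (mul (star x) (mono g))).
Proof. by rewrite /ip mulA (ev_mulC cl_nphi). Qed.

(** n phi(p_i g p_i) = n phi(p_i g), as n phi is tracial and p_i is idempotent. *)
Lemma piece_one_sided : exists c, forall i e y g, 0 < e <= 1 -> near i e y ->
  normc (Phi i g - ip f (vmap y) (mono g)) <= c * e.
Proof.
have [c hc] := near_product; exists (k + c) => i e y g he hy.
have := PhiP g he hy; have := hc i i e (star y) y g he (near_star hy) hy.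
rewrite eqxx mul1r vmap_star -ip_rotate -/(ip f (vmap y) (mono g)).
set u := ip f _ (mul _ _); set v := ip f _ _ => h1 h2.
have -> : Phi i g - v = (Phi i g - u) + (u - v) by ring.
apply: le_trans (normc_add _ _) _; lra.
Qed.

Lemma piece_restrict i x : Phi i (val x) = psi i x.
Proof.
apply/eqP; rewrite -subr_eq0; apply/eqP.
have [c hc] := piece_one_sided.
apply: (@normc_eq0_of_small _ (c + n%:R)) => e he; have /andP[e0 _] := he.
have [y hy] := near_exists i e0.
have := hc i e y (val x) he hy; rewrite -vmap_mono ip_nphi_vmap.
set u := \sum_(j < n) _ => h.
have : normc (u - psi i x) <= n%:R * e.
  have -> : u - psi i x = \sum_(j < n) ip (psi j) (sub y (delta i j)) (mono x).
    under eq_bigr do rewrite ip_subl; rewrite sumrB; congr (_ - _).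
    rewrite (bigD1 i) //= big1 => [|j /negbTE ji]; last first.
      by rewrite /Kronecker eq_sym ji ip_sum big_nil.
    by rewrite /Kronecker eqxx ip_monol ev_mono addr0.
  apply: le_trans (normc_sum _ _ _) _.
  rewrite (mulr_natl _ n) -[X in _ *+ X]card_ord -sumr_const.
  apply: ler_sum => j _; apply: le_trans (cauchy_schwarz (pd_psi j) _ _) _.
  by rewrite nm_mono nm_one // mulr1; exact: hy.
have -> : Phi i (val x) - psi i x = (Phi i (val x) - u) + (u - psi i x) by ring.
by move=> h'; apply: le_trans (normc_add _ _) _; rewrite mulrDl; exact: lerD.
Qed.

Lemma piece_conj h i j x : act h i j -> Phi i (x ^ h)%g = Phi j x.
Proof.
move=> hij; apply/eqP; rewrite -subr_eq0; apply/eqP.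
apply: (@normc_eq0_of_small _ (2 * k)) => e he; have /andP[e0 _] := he.
have [y hy] := near_exists j e0.
have := PhiP (x ^ h)%g he (near_conj hij hy); have := PhiP x he hy.
rewrite vmap_conjN -conja_mono -conja_mul ip_conja; last exact: cl_nphi.
set v := ip f _ _.
have -> : Phi i (x ^ h)%g - Phi j x = (Phi i (x ^ h)%g - v) - (Phi j x - v) by ring.
have := normc_sub (Phi i (x ^ h)%g - v) (Phi j x - v); lra.
Qed.

(** If g carries psi_m to psi_i with m distinct from i, then g^-1 p_i g = p_m, so
    p_i g p_i is conjugate to p_m p_i g = 0. *)
Lemma piece_off i g : g \notin isotropy nN (psi i) -> Phi i g = 0.
Proof.
move=> /isotropyP gi; have [c hc] := near_product.
apply: (@normc_eq0_of_small _ (k + c)) => e he; have /andP[e0 _] := he.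
have [y hy] := near_exists i e0.
have [m hm] := psi_perm.1 g^-1%g i.
have hgm : act g m i by rewrite -hm -trace_actM mulgV trace_act1.
have im : i != m by apply/eqP => e'; apply: gi; rewrite {1}e'.
have hz := near_conj hgm (near_star hy).
have := PhiP g he hy; have := hc i m e y _ g he hy hz.
rewrite (negbTE im) mul0r subr0 vmap_conjN vmap_star.
set Y := vmap y; set u := ip f _ _.
have -> : ev f (mul (conja g (star Y)) (mul Y (mono g))) = u.
  rewrite /u /ip ev_mul ev_conja [RHS]ev_mul; apply: eq_ev => a.
  rewrite !ev_mul ev_mono; apply: eq_ev => b.
  by rewrite ev_mono -(cl_nphi (a * (g * b))%g g) !conjgE !mulgA.
move=> h1 h2; have := normc_le_dist (Phi i g) u; lra.
Qed.

Lemma piece_sum g : \sum_(i < n) Phi i g = f g.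
Proof.
apply/eqP; rewrite -subr_eq0; apply/eqP.
have [c hc] := piece_one_sided; pose nR : R := n%:R.
apply: (@normc_eq0_of_small _ (nR * c + nR * nR * nm f oneG)) => e he.
have /andP[e0 _] := he.
have [y hy] := approx_central_projections psi_trace psi_disj e0.
pose d := sub (\big[cat/[::]]_(i < n) y i) one.
have nd : nm f (vmap d) <= nR * nR * e.
  apply: le_trans (nm_nphi_vmap _) _.
  rewrite -mulrA (mulr_natl _ n) -[X in _ *+ X]card_ord -sumr_const; apply: ler_sum => m _.
  have -> : nm (psi m) d = nm (psi m) (\big[cat/[::]]_(i < n) sub (y i) (delta i m)).
    apply: nm_eq => F; rewrite ev_sub !ev_bigcat.
    under [RHS]eq_bigr do rewrite ev_sub; rewrite sumrB; congr (_ - _).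
    rewrite (bigD1 m) //= /Kronecker eqxx big1 ?addr0 // => i /negbTE ->.
    by rewrite ev_nil.
  apply: le_trans (nm_bigcat _ _ _ (pd_psi m)) _.
  rewrite (mulr_natl _ n) -[X in _ *+ X]card_ord -sumr_const; apply: ler_sum => i _.
  exact: hy.
have -> : \sum_(i < n) Phi i g - f g =
    \sum_(i < n) (Phi i g - ip f (vmap (y i)) (mono g)) + ip f (vmap d) (mono g).
  rewrite /d vmap_sub ip_subl vmap_mono ip_monol ev_mono sumrB.
  suff -> : ip f (vmap (\big[cat/[::]]_(i < n) y i)) (mono g) =
    \sum_(i < n) ip f (vmap (y i)) (mono g) by ring.
  apply: (big_morph (fun y => ip f (vmap y) (mono g))) => [u v|].
    by rewrite /vmap map_cat ip_catl.
  by rewrite ip_sum big_nil.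
apply: le_trans (normc_add _ _) _; rewrite mulrDl; apply: lerD.
  apply: le_trans (normc_sum _ _ _) _.
  rewrite -mulrA (mulr_natl _ n) -[X in _ *+ X]card_ord -sumr_const; apply: ler_sum => i _.
  exact: hc.
apply: le_trans (cauchy_schwarz pd_nphi _ _) _.
by rewrite nm_mono mulrAC; apply: ler_wpM2r => //; exact: nm_ge0.
Qed.

Section Induced.
Variables (i : 'I_n) (r : 'I_n -> G).
Hypothesis r_psi : forall j, act (r j) i j.
Local Notation H := (isotropy nN (psi i)).
Implicit Types a b : subgroup H -> C.

Let n_neq0 : n%:R != 0 :> C.
Proof. by rewrite pnatr_eq0 -lt0n; case: (n) i => // -[]. Qed.

Lemma Ind_isotropy a x : conj_invariant a ->
  Ind a x = n%:R^-1 * \sum_(j < n) zero_ext a (x ^ r j)%g.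
Proof. exact: (IndE psi_inj (fun g => psi_perm.1 g i) r_psi). Qed.

Lemma ip_conjf (F : G -> C) h x y :
  ip (fun g => F (g ^ h)%g) x y = ip F (conja h x) (conja h y).
Proof. by rewrite /ip -conja_star -conja_mul ev_conja. Qed.

Lemma Ind_trace a : is_trace a -> is_trace (Ind a).
Proof.
move=> [pda cla a1]; split.
- apply/positive_definiteP => x.
  rewrite /ip (eq_ev _ (fun g => Ind_isotropy g cla)) ev_cst_mul.
  rewrite mulr_ge0 ?invr_ge0 ?ler0n // -/(ip _ x x) ip_sumf sumr_ge0 // => j _.
  by rewrite ip_conjf; apply: ip_ge0; exact: zero_ext_pd.
- move=> x g; rewrite !Ind_isotropy //; congr (_ * _).
  have /choice[s hs] := psi_perm.1 g.
  have s_inj : injective s.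
    move=> j m e; apply: psi_inj; apply: (@trace_act_inj _ _ _ nN g).
    by rewrite !hs e.
  rewrite [RHS](reindex_inj s_inj) /=; apply: eq_bigr => j _.
  rewrite -conjgM; apply: zero_ext_coset => //.
  by rewrite trace_actM r_psi hs r_psi.
- rewrite Ind_isotropy // (eq_bigr (fun=> 1)) => [|j _]; last first.
    by rewrite conj1g -a1 -zero_ext_val.
  by rewrite sumr_const card_ord mulVf.
Qed.

(** Compression by p_i separates the conjugates of [a] in n phi = n Ind a.  The
    conjugate by [r j] sees p_i as the projection p_m with [r j] psi_m = psi_i;
    by the bound on [a] this is 1 in L^2(a) when j = i and 0 otherwise. *)
Lemma piece_unique a K : is_trace a -> 0 <= K ->
  (forall z, nm (zero_ext a) (vmap z) <= K * nm (psi i) z) ->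
  phi =1 Ind a -> forall g : subgroup H, a g = Phi i (val g).
Proof.
move=> [pda cla a1] K0 aK phiE g.
have pdA := zero_ext_pd pda; set A := zero_ext a in pdA aK.
have fE x : f x = \sum_(j < n) A (x ^ r j)%g.
  by rewrite /f phiE Ind_isotropy // mulrA divff // mul1r.
have A1 : nm A oneG = 1 by apply: nm_one; rewrite -a1 -zero_ext_val.
apply/eqP; rewrite eq_sym -subr_eq0; apply/eqP; pose nR : R := n%:R.
apply: (@normc_eq0_of_small _ (k + (nR * K ^+ 2 + K * (2 + K)))) => e he.
have /andP[e0 e1] := he; have [y hy] := near_exists i e0.
have := PhiP (val g) he hy; set u := ip f _ _.
suff : normc (u - a g) <= (nR * K ^+ 2 + K * (2 + K)) * e.
  have := normc_add (Phi i (val g) - u) (u - a g).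
  by rewrite addrA subrK; lra.
(* w j is the contribution of the conjugate of a by r j to n phi(y^* g y). *)
pose Y j := vmap (conjN (r j) y).
pose w j := ip A (Y j) (mul (mono (val g ^ r j)%g) (Y j)).
have uE : u = \sum_(j < n) w j.
  rewrite /u /ip (eq_ev _ fE) -/(ip _ _ _) ip_sumf; apply: eq_bigr => j _.
  by rewrite ip_conjf conja_mul -!vmap_conjN.
have K2 : K ^+ 2 * e ^+ 2 <= K ^+ 2 * e.
  by apply: ler_wpM2l; rewrite ?sqr_ge0 // expr2 ler_piMl // ltW.
have w_off j : j != i -> normc (w j) <= K ^+ 2 * e.
  move=> ji; have [m hm] := psi_perm.1 (r j)^-1%g i.
  have hjm : act (r j) m i by rewrite -hm -trace_actM mulgV trace_act1.
  have mi : m != i.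
    apply: contraNneq ji => mi; apply/eqP/psi_inj.
    by move: hjm; rewrite mi r_psi.
  have := near_off mi (near_conj hjm hy) => hz.
  have hY : nm A (Y j) <= K * e.
    by apply: le_trans (aK _) _; apply: ler_wpM2l.
  apply: le_trans (cauchy_schwarz pdA _ _) _; rewrite nm_mono_mul.
  apply: le_trans K2; rewrite -exprMn expr2.
  by apply: ler_pM; rewrite ?nm_ge0.
have w_on : normc (w i - a g) <= K * (2 + K) * e.
  (* Here r i fixes psi_i, so Y i still approximates 1 in L^2 of a. *)
  have hii : act (r i) i i by exact: r_psi.
  have := near_conj hii hy => /(_ i); rewrite /Kronecker eqxx => hz.
  have hY : nm A (sub (Y i) oneG) <= K * e.
    rewrite -[oneG](vmap_mono R (1%g : M)) -vmap_sub; apply: le_trans (aK _) _.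
    exact: ler_wpM2l.
  have hY' : nm A (Y i) <= K * e + 1.
    by apply: le_trans (nm_le_sub pdA _ oneG) _; rewrite A1 lerD2r.
  have agE : a g = ip A oneG (mul (mono (val g ^ r i)%g) oneG).
    rewrite ip_monol mul_mono mulg1 ev_mono /A zero_ext_conj ?zero_ext_val //.
    exact/isotropyP.
  have -> : w i - a g = ip A (sub (Y i) oneG) (mul (mono (val g ^ r i)%g) (Y i)) +
      ip A oneG (mul (mono (val g ^ r i)%g) (sub (Y i) oneG)).
    by rewrite agE /w ip_mul_subr ip_subl; ring.
  apply: le_trans (normc_add _ _) _.
  have := cauchy_schwarz pdA (sub (Y i) oneG) (mul (mono (val g ^ r i)%g) (Y i)).
  have := cauchy_schwarz pdA oneG (mul (mono (val g ^ r i)%g) (sub (Y i) oneG)).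
  rewrite !nm_mono_mul A1 mul1r.
  have : nm A (sub (Y i) oneG) * nm A (Y i) <= K * e * (K * e + 1).
    by apply: ler_pM; rewrite ?nm_ge0.
  lra.
rewrite uE (bigD1 i) //= addrAC; apply: le_trans (normc_add _ _) _.
rewrite mulrDl [X in _ <= X]addrC; apply: lerD; first exact: w_on.
apply: le_trans (normc_sum _ _ _) _.
apply: le_trans (_ : \sum_(j < n | j != i) K ^+ 2 * e <= _).
  by apply: ler_sum => j; exact: w_off.
rewrite -mulrA (mulr_natl _ n) -[X in _ *+ X]card_ord -sumr_const.
rewrite big_mkcond; apply: ler_sum => j _; case: ifP => // _.
by rewrite mulr_ge0 ?sqr_ge0 ?ltW.
Qed.

Lemma piece_trace : is_trace (fun g : subgroup H => Phi i (val g)).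
Proof.
split; first exact: pd_restrict.
- move=> x g; rewrite -[RHS](@piece_conj (val g) i i) //.
  exact/isotropyP/sgvalP.
- by rewrite -(psi1 i) -piece_restrict.
Qed.

Lemma zero_ext_piece g : zero_ext (fun g : subgroup H => Phi i (val g)) g = Phi i g.
Proof.
case: (boolP (g \in H)) => gH; first by rewrite (zero_ext_in _ gH).
by rewrite zero_ext_notin // piece_off.
Qed.

Lemma piece_induced : phi =1 Ind (fun g : subgroup H => Phi i (val g)).
Proof.
move=> x; have [_ cl _] := piece_trace; rewrite Ind_isotropy //.
rewrite (eq_bigr (fun j => Phi j x)) => [|j _]; last first.
  by rewrite zero_ext_piece; exact: piece_conj.
by rewrite piece_sum /nphi mulrA mulVf // mul1r.
Qed.

Lemma piece_extends : extends (psi i) (fun g : subgroup H => Phi i (val g)).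
Proof.
move=> x; have xH : val x \in H.
  apply/isotropyP/funext => z; rewrite /trace_act -[RHS](cl_psi i z x).
  by congr psi; apply: val_inj.
by exists (Subgroup xH) => //=; exact: piece_restrict.
Qed.

(** t a is a summand of phi_i, which equals psi_i on N; as t <= 1, the factor
    1 / sqrt t may be replaced by 1 / t. *)
Lemma summand_dominated a b (t : R) : is_trace a -> is_trace b -> 0 < t < 1 ->
  (forall g : subgroup H, Phi i (val g) = t%:C * a g + (1 - t)%:C * b g) ->
  forall z, nm (zero_ext a) (vmap z) <= t^-1 * nm (psi i) z.
Proof.
move=> [pda _ _] [pdb _ _] /andP[t0 t1] dec z.
have PhiE g : Phi i g = t%:C * zero_ext a g + (1 - t)%:C * zero_ext b g.
  case: (boolP (g \in H)) => gH; first by rewrite !zero_ext_in -dec.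
  by rewrite piece_off // !zero_ext_notin // !mulr0 addr0.
have e : nm (psi i) z ^+ 2 = t * nm (zero_ext a) (vmap z) ^+ 2 +
    (1 - t) * nm (zero_ext b) (vmap z) ^+ 2.
  apply: complexI; rewrite rmorphD (rmorphM _ t) (rmorphM _ (1 - t)) /=.
  rewrite -!ip_nm //; try exact: zero_ext_pd.
  rewrite -[LHS](_ : ip (Phi i) (vmap z) (vmap z) = _); last first.
    by rewrite ip_vmap; apply: eq_ev; exact: piece_restrict.
  by rewrite /ip (eq_ev _ PhiE) ev_add !ev_cst_mul.
have tI : 1 <= t^-1 by rewrite invf_ge1 // ltW.
rewrite -ler_sqr ?nnegrE ?mulr_ge0 ?nm_ge0 ?invr_ge0 ?(ltW t0) // exprMn.
apply: le_trans (_ : t^-1 * nm (psi i) z ^+ 2 <= _); last first.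
  by apply: ler_wpM2r; rewrite ?sqr_ge0 // expr2 ler_peMl // invr_ge0 ltW.
rewrite [t^-1 * _]mulrC ler_pdivlMr // e [_ * t]mulrC lerDl.
by rewrite mulr_ge0 ?sqr_ge0 // subr_ge0 ltW.
Qed.

(** Induction is affine and phi is extreme, so both components of a convex
    decomposition of phi_i induce phi. *)
Lemma piece_character : is_character phi ->
  is_character (fun g : subgroup H => Phi i (val g)).
Proof.
move=> [_ ext]; split; first exact: piece_trace.
move=> a b t tra trb t01 dec; have /andP[t0 t1] := t01.
have [_ cla _] := tra; have [_ clb _] := trb.
have [_ cl _] := piece_trace.
have IndD x : phi x = t%:C * Ind a x + (1 - t)%:C * Ind b x.
  rewrite piece_induced !Ind_isotropy //.
  rewrite (mulrCA t%:C) (mulrCA (1 - t)%:C) -mulrDr; congr (_ * _).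
  rewrite !mulr_sumr -big_split /=.
  apply: eq_bigr => j _; set y := (x ^ r j)%g.
  case: (boolP (y \in H)) => yH; first by rewrite !zero_ext_in dec.
  by rewrite !zero_ext_notin // !mulr0 addr0.
have eqI := ext _ _ t (Ind_trace tra) (Ind_trace trb) t01 IndD.
have tC x : t%:C * x + (1 - t)%:C * x = x :> C.
  by rewrite -mulrDl -rmorphD /= addrC subrK mul1r.
have phia : phi =1 Ind a by move=> x; rewrite IndD -eqI tC.
have phib : phi =1 Ind b by move=> x; rewrite phia eqI.
have s01 : 0 < 1 - t < 1 by apply/andP; split; lra.
have dec' g : Phi i (val g) = (1 - t)%:C * b g + (1 - (1 - t))%:C * a g.
  by rewrite dec addrC; congr (_ + _%:C * _); ring.
move=> g; have [s0 _] := andP s01.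
rewrite (piece_unique tra _ (summand_dominated tra trb t01 dec) phia) ?invr_ge0 ?(ltW t0) //.
by rewrite (piece_unique trb _ (summand_dominated trb tra s01 dec') phib) ?invr_ge0 ?(ltW s0).
Qed.

Lemma finite_index_isotropy : finite_index H.
Proof. exact: (finite_isotropy (fun g => psi_perm.1 g i) r_psi). Qed.

End Induced.
End Pieces.
End Clifford.

Unset Implicit Arguments.

Theorem theorem3p3 (R : realType) (G : groupType) (N : groupClosed G)
    (nN : is_normal N) (phi : G -> R[i]) (phi_char : is_character phi)
    (n : nat) (n_gt0 : (0 < n)%N) (psi : 'I_n -> subgroup N -> R[i])
    (psi_trace : forall i, is_trace (psi i))
    (psi_disj : forall i j, i != j -> disjoint_traces (psi i) (psi j))
    (psi_perm : permuted_transitively nN psi)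
    (phi_restr : forall x : subgroup N,
      phi (val x) = n%:R^-1 * \sum_(i < n) psi i x) :
  forall i : 'I_n,
    finite_index (isotropy nN (psi i)) /\
    exists phi_i : subgroup (isotropy nN (psi i)) -> R[i],
      [/\ is_character phi_i,
          extends (psi i) phi_i &
          phi =1 Ind phi_i].
Proof.
move=> i; have phi_trace := phi_char.1.
have /choice[r r_psi] := psi_perm.2 i.
split; first exact: (finite_index_isotropy psi_perm r_psi).
have [Phi [k [pdP PhiP]]] :=
  pieces_exist phi_trace psi_trace psi_disj phi_restr.
exists (fun g => Phi i (val g)); split.
- exact: (piece_character phi_trace psi_trace psi_disj psi_perm phi_restr pdP PhiP r_psi phi_char).
- exact: (piece_extends nN phi_trace psi_trace psi_disj phi_restr PhiP).
- exact: (piece_induced phi_trace psi_trace psi_disj psi_perm phi_restr pdP PhiP r_psi).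
Qed.
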